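(* Assume $T^{-1/6}=O(\epsilon)$. There exists a one-pass streaming algorithm in the arbitrary order model which, given access to a perfect oracle that for an edge $xy$ outputs TRUE if $N_{xy}\ge T/\rho$ and FALSE otherwise (for a parameter $\rho$ chosen by the algorithm), uses space $\tilde{O}(T^{1/3}+\epsilon^{-2} m/T^{1/3})$ and returns a $(1\pm\epsilon)$-approximation to the number $T$ of four-cycles of the input graph with probability at least $7/10$.
   Context: $G=(V,E)$ is a simple undirected graph with $n$ vertices, $m$ edges, and $T$ four-cycles (cycles of length 4); $0<\epsilon<1$. Arbitrary order model: edges arrive one at a time in arbitrary order, one pass. For an edge $xy$, $N_{xy}=|\{\{z,w\}: x,y,z,w \text{ form a 4-cycle containing edge } xy\}|$ is the number of 4-cycles containing the edge $xy$. The algorithm is assumed to know a constant-factor approximation of $T$ for setting parameters. $\tilde{O}(f)=O(f\cdot\mathrm{polylog}(f))$; space is measured in stored edges/words. *)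

(* Defs.v *)
From HB Require Import structures.
From mathcomp Require Import all_boot all_order all_algebra.
From mathcomp Require Import reals exp.

Set Implicit Arguments.
Unset Strict Implicit.
Unset Printing Implicit Defensive.
Import Order.TTheory GRing.Theory Num.Theory.
Local Open Scope ring_scope.

Record sgraph (V : finType) := SGraph {
  adj : rel V;
  adj_sym : symmetric adj;
  adj_irr : irreflexive adj }.

Section FourCycles.
Variables (V : finType) (G : sgraph V).

Definition edges : {set {set V}} :=
  [set [set p.1; p.2] | p in [set p : V * V | adj G p.1 p.2]].

Definition cycle4_edges (x y z w : V) : {set {set V}} :=
  [set [set x; y]; [set y; z]; [set z; w]; [set w; x]].

(* A 4-cycle is identified with its set of four edges, so that the 8 traversals
   of the same cycle count once, and the up to three different 4-cycles on the
   same four vertices are kept apart. *)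
Definition four_cycles : {set {set {set V}}} :=
  [set F | [exists x, exists y, exists z, exists w,
     [&& uniq [:: x; y; z; w],
         adj G x y, adj G y z, adj G z w, adj G w x
       & F == cycle4_edges x y z w]]].

Definition num_C4 : nat := #|four_cycles|.

Definition num_C4_at (e : {set V}) : nat :=
  #|[set F in four_cycles | e \in F]|.

End FourCycles.

Section Streaming.
Variable R : realType.

(* A machine word on n-vertex inputs: just enough bits to hold a vertex. *)
Definition word (n : nat) := (trunc_log 2 n).+1.-tuple bool.

(* One-pass randomized streaming algorithm on graphs with vertex set 'I_n.
   Between two arrivals the only information kept is the list of words in
   memory: in particular the position in the stream and any random choice that
   is to be reused have to be stored there. Each step draws a fresh uniform
   element of sa_seed. The boolean argument of sa_step is the oracle's answer on
   the arriving edge, for the threshold parameter sa_rho. *)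
Record stream_alg (n : nat) := StreamAlg {
  sa_rho : R;
  sa_rho_gt0 : 0 < sa_rho;
  sa_seed : finType;
  sa_init : sa_seed -> seq (word n);
  sa_step : seq (word n) -> {set 'I_n} -> bool -> sa_seed -> seq (word n);
  sa_out : seq (word n) -> R }.

Definition perfect_oracle (V : finType) (G : sgraph V) (rho : R)
    (o : {set V} -> bool) : Prop :=
  forall e, e \in edges G ->
    o e = ((num_C4 G)%:R / rho <= (num_C4_at G e)%:R).

Section Run.
Variables (n : nat) (A : stream_alg n) (o : {set 'I_n} -> bool).
Variable s : seq {set 'I_n}.

(* one seed for the initialization and one for each arrival *)
Definition coins : finType := (sa_seed A * (size s).-tuple (sa_seed A))%type.

Definition later_memories (r : coins) : seq (seq (word n)) :=
  scanl (fun M er => sa_step M er.1 (o er.1) er.2) (sa_init r.1) (zip s r.2).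

Definition memories (r : coins) : seq (seq (word n)) :=
  sa_init r.1 :: later_memories r.

Definition output (r : coins) : R :=
  sa_out A (last (sa_init r.1) (later_memories r)).

Definition prob (P : pred coins) : R := #|P|%:R / #|coins|%:R.

(* Worst case over the random choices. *)
Definition uses_space (b : R) : Prop :=
  forall r M, M \in memories r -> (size M)%:R <= b.

End Run.

Definition edge_stream (n : nat) (G : sgraph 'I_n) (s : seq {set 'I_n}) : Prop :=
  uniq s /\ s =i edges G.

Definition approx (eps t x : R) : bool :=
  (1 - eps) * t <= x <= (1 + eps) * t.

(* "at most softO c k f, for constants c and k" is "Otilde(f)" *)
Definition softO (c : R) (k : nat) (f : R) : R := c * (f * ln f ^+ k).

Definition space_fun (eps m t : R) : R :=
  t `^ (3^-1) + eps ^- 2 * (m / t `^ (3^-1)).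

End Streaming.

(* Main.v *)
(* Write rho = Q' for (a power of two near) the cube root of T and let Q be about
   eps^2 Q' / (10^4 C), rounded to a power of two and at least 1.  Edges on at
   least T/Q' four-cycles are always stored (there are at most 4 Q' of them); the
   others are sampled at rate 1/Q.  Counting a cycle when its last edge arrives
   and the first three are stored has small variance except for pairs of cycles
   sharing a wedge, i.e. for cycles whose diagonal has many common neighbours, as
   in K_{2,d}.  Those cycles are counted differently: vertices are sampled at rate
   1/Q together with their edges, and a cycle is found when two opposite vertices
   are sampled.  A diagonal is declared dense when two of its common neighbours so
   far lie in a third, independent vertex sample of rate 1/Q'.  With d common
   neighbours this happens with probability at most min(d/Q', (d/Q')^2) and fails
   with probability at most 4Q'/d, and these bounds are what makes both variances
   O(eps^2 T^2).

   All samples come from polynomial hash functions of degree 5 over a finite field,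
   so that a seed fits in O(1) words.  To bound the space in the worst case a run
   fails once it stores more than 200 j H_j^2 / Q light edges among the first j,
   with H_j the harmonic sum; weighting the j-th edge by 1/(j H_j^2), a summable
   sequence, one application of Markov's inequality bounds the probability that
   this ever happens. *)

Require Import Defs.
From HB Require Import structures.
From mathcomp Require Import all_boot all_order all_algebra.
From mathcomp Require Import reals exp.
From mathcomp Require Import finfield.
From mathcomp Require Import ring lra zify.
From mathcomp Require boolp.

Set Implicit Arguments.
Unset Strict Implicit.
Unset Printing Implicit Defensive.
Import Order.TTheory GRing.Theory Num.Theory.
Local Open Scope ring_scope.

(** * Averages over a finite sample space *)

Section Mean.
Variable R : realType.

Definition mean (Om : finType) (f : Om -> R) : R := (\sum_t f t) / #|Om|%:R.

Lemma meanD (Om : finType) (f g : Om -> R) :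
  mean (fun t => f t + g t) = mean f + mean g.
Proof. by rewrite /mean big_split mulrDl. Qed.

Lemma meanZ (Om : finType) (a : R) (f : Om -> R) :
  mean (fun t => a * f t) = a * mean f.
Proof. by rewrite /mean -mulr_sumr mulrA. Qed.

Lemma mean_sum (Om I : finType) (P : pred I) (f : I -> Om -> R) :
  mean (fun t => \sum_(i | P i) f i t) = \sum_(i | P i) mean (f i).
Proof. by rewrite /mean exchange_big /= mulr_suml. Qed.

Lemma eq_mean (Om : finType) (f g : Om -> R) : f =1 g -> mean f = mean g.
Proof. by move=> fg; rewrite /mean; congr (_ / _); apply: eq_bigr. Qed.

Lemma mean_le (Om : finType) (f g : Om -> R) :
  (forall t, f t <= g t) -> mean f <= mean g.
Proof. by move=> fg; rewrite ler_wpM2r ?invr_ge0 // ler_sum. Qed.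

Lemma mean_ge0 (Om : finType) (f : Om -> R) :
  (forall t, 0 <= f t) -> 0 <= mean f.
Proof. by move=> f0; rewrite divr_ge0 // sumr_ge0. Qed.

Lemma mean_const (Om : finType) (a : R) :
  (0 < #|Om|)%N -> mean (fun _ : Om => a) = a.
Proof.
move=> Om0; rewrite /mean sumr_const -(mulr_natr a) mulfK //.
by rewrite pnatr_eq0 -lt0n.
Qed.

Lemma mean_pair (Om Om' : finType) (f : Om * Om' -> R) :
  mean f = mean (fun t => mean (fun t' => f (t, t'))).
Proof.
rewrite /mean card_prod natrM invfM -mulr_suml.
rewrite (pair_bigA _ (fun i j => f (i, j))) /= [X in _ * X = _]mulrC mulrA.
by congr (_ * _ * _); apply: eq_bigr => -[].
Qed.

Lemma mean_swap (Om Om' : finType) (f : Om -> Om' -> R) :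
  mean (fun t => mean (f t)) = mean (fun t' => mean (f^~ t')).
Proof.
rewrite /mean -!mulr_suml exchange_big /= -!mulrA; congr (_ * _).
exact: mulrC.
Qed.

Lemma markov_mean (Om : finType) (f : Om -> R) (a : R) :
  0 < a -> (forall t, 0 <= f t) ->
  #|[pred t | a <= f t]|%:R / #|Om|%:R <= mean f / a.
Proof.
move=> a0 f0; rewrite /mean mulrAC ler_wpM2r ?invr_ge0 // ler_pdivlMr //.
rewrite -sum1_card natr_sum mulr_suml [leRHS](bigID (fun t => a <= f t)) /=.
rewrite -[leLHS]addr0 lerD ?sumr_ge0 //.
by apply: ler_sum => t; rewrite inE mul1r.
Qed.

End Mean.

(** * Limited independence *)

Section Sampler.
Variable R : realType.

(** Independence of order [k] at rate 1/Q, stated through product moments, which is all that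
    second-moment computations need. The restriction to [dom] matters for edges: they are hashed
    through a pair of endpoints, which need not identify a set that is not an edge. *)
Definition sampler (Om X : finType) (dom : {set X}) (k Q : nat)
    (smp : Om -> X -> bool) : Prop :=
  forall A : {set X}, A \subset dom -> (#|A| <= k)%N ->
    mean (fun t => \prod_(x in A) (smp t x)%:R) = (Q%:R^-1 : R) ^+ #|A|.

Variables (Om X : finType) (dom : {set X}) (k Q : nat).
Variable smp : Om -> X -> bool.
Hypothesis smpP : sampler dom k Q smp.
Hypothesis Q_gt0 : (0 < Q)%N.

Let Qn0 : Q%:R != 0 :> R. Proof. by rewrite pnatr_eq0 -lt0n. Qed.

(** Horvitz-Thompson weight: the indicator that all of [A] is sampled, divided by its
    probability. *)
Definition inv_weight (A : {set X}) (t : Om) : R :=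
  Q%:R ^+ #|A| * \prod_(x in A) (smp t x)%:R.

Lemma prodr_bool_setU (A B : {set X}) (b : X -> bool) :
  (\prod_(x in A) (b x)%:R) * (\prod_(x in B) (b x)%:R)
  = \prod_(x in A :|: B) (b x)%:R :> R.
Proof.
have P (D : {set X}) :
    \prod_(x in D) (b x)%:R = [forall x in D, b x]%:R :> R.
  case: (boolP [forall x in D, b x]) => [/forall_inP bD | nbD].
    by rewrite big1 // => x xD; rewrite bD.
  have /forall_inPn[x xD /negbTE bx] := nbD.
  by rewrite (bigD1 x) //= bx mul0r.
rewrite !P -natrM mulnb; congr (_%:R); congr nat_of_bool.
apply/andP/forall_inP => [[/forall_inP hA /forall_inP hB] x | h].
  by rewrite inE => /orP[/hA|/hB].
by split; apply/forall_inP => x xA; apply: h; rewrite inE xA ?orbT.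
Qed.

Lemma mean_inv_weight (A : {set X}) :
  A \subset dom -> (#|A| <= k)%N -> mean (inv_weight A) = 1.
Proof.
by move=> sA cA; rewrite /inv_weight meanZ smpP // -exprMn divff // expr1n.
Qed.

(** Indicators are idempotent, so a point common to [A] and [B] is sampled once but weighted twice,
    which leaves one factor Q. *)
Lemma mean_inv_weightM (A B : {set X}) :
  A \subset dom -> B \subset dom -> (#|A| + #|B| <= k)%N ->
  mean (fun t => inv_weight A t * inv_weight B t) = Q%:R ^+ #|A :&: B|.
Proof.
move=> sA sB cAB.
have -> : mean (fun t => inv_weight A t * inv_weight B t)
    = mean (fun t => Q%:R ^+ (#|A| + #|B|)
                     * \prod_(x in A :|: B) (smp t x)%:R).
  apply: eq_mean => t; rewrite -prodr_bool_setU exprD /inv_weight; ring.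
rewrite meanZ smpP ?subUset ?sA //; last first.
  by rewrite (leq_trans _ cAB) // -cardsUI leq_addr.
rewrite -cardsUI exprD -mulrA [X in _ * X]mulrC mulrA -exprMn divff //.
by rewrite expr1n mul1r.
Qed.

(** Only pairs whose sets meet contribute. A cycle has up to three sampled edges, so a product of
    two weights involves up to six points: hence hash functions with six coefficients. *)
Lemma sampled_sum_variance (I : finType) (J : {set I}) (c : I -> R)
    (A : I -> {set X}) :
  (0 < #|Om|)%N ->
  (forall i, i \in J -> A i \subset dom) ->
  (forall i, i \in J -> (#|A i|.*2 <= k)%N) ->
  mean (fun t => (\sum_(i in J) c i * inv_weight (A i) t
                  - \sum_(i in J) c i) ^+ 2)
  = \sum_(i in J) \sum_(j in J) c i * c j * (Q%:R ^+ #|A i :&: A j| - 1).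
Proof.
move=> Om0 sA cA.
have -> : mean (fun t => (\sum_(i in J) c i * inv_weight (A i) t
                  - \sum_(i in J) c i) ^+ 2)
  = mean (fun t => \sum_(i in J) \sum_(j in J) c i * c j *
       (inv_weight (A i) t * inv_weight (A j) t
         + (-1 * inv_weight (A i) t + (-1 * inv_weight (A j) t + 1)))).
  apply: eq_mean => t; rewrite -sumrB expr2 mulr_suml; apply: eq_bigr => i _.
  rewrite mulr_sumr; apply: eq_bigr => j _; ring.
rewrite mean_sum; apply: eq_bigr => i iJ.
rewrite mean_sum; apply: eq_bigr => j jJ.
have ci := cA i iJ; have cj := cA j jJ.
rewrite meanZ !meanD !(meanZ (-1)) mean_const // mean_inv_weightM ?sA //; last by lia.
rewrite !mean_inv_weight ?sA //; try lia.
by congr (_ * _); ring.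
Qed.

Lemma mean_sampler1 (x : X) :
  (0 < k)%N -> x \in dom -> mean (fun t => (smp t x)%:R) = Q%:R^-1 :> R.
Proof.
move=> k0 xd; have := @smpP [set x].
rewrite sub1set xd cards1 => /(_ isT k0); rewrite expr1 => <-.
by apply: eq_mean => t; rewrite big_set1.
Qed.

Lemma mean_sampler2 (x y : X) :
  (1 < k)%N -> x \in dom -> y \in dom -> x != y ->
  mean (fun t => (smp t x && smp t y)%:R) = Q%:R^-1 ^+ 2 :> R.
Proof.
move=> k0 xd yd xy; have := @smpP [set x; y].
rewrite subUset !sub1set xd yd cards2 xy => /(_ isT k0) <-.
by apply: eq_mean => t; rewrite big_setU1 ?inE //= big_set1 -natrM mulnb.
Qed.

Definition hits (N : {set X}) (t : Om) := #|[set x in N | smp t x]|.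

Lemma hitsE (N : {set X}) (t : Om) :
  (hits N t)%:R = \sum_(x in N) (smp t x)%:R :> R.
Proof.
rewrite /hits -sum1_card natr_sum big_mkcond [RHS]big_mkcond /=.
by apply: eq_bigr => x _; rewrite inE; case: (x \in N); case: (smp t x).
Qed.

Lemma prob_hits_ge1 (N : {set X}) :
  (0 < k)%N -> N \subset dom ->
  mean (fun t => (0 < hits N t)%N%:R) <= #|N|%:R / Q%:R :> R.
Proof.
move=> k0 /subsetP sN; apply: (@le_trans _ _ (mean (fun t => (hits N t)%:R))).
  by apply: mean_le => t; rewrite ler_nat; case: (hits N t).
have -> : mean (fun t => (hits N t)%:R)
    = mean (fun t => \sum_(x in N) (smp t x)%:R) :> R.
  by apply: eq_mean => t; rewrite hitsE.
rewrite mean_sum (eq_bigr (fun=> Q%:R^-1)) => [|x xN].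
  by rewrite sumr_const -[leLHS]mulr_natl.
by rewrite mean_sampler1 ?sN.
Qed.

(** First moment of the number of ordered pairs of distinct sampled points. *)
Lemma prob_hits_ge2 (N : {set X}) :
  (1 < k)%N -> N \subset dom ->
  mean (fun t => (1 < hits N t)%N%:R) <= (#|N|%:R / Q%:R) ^+ 2 :> R.
Proof.
move=> k1 /subsetP sN.
apply: (@le_trans _ _ (mean (fun t => \sum_(x in N) \sum_(y in N | x != y)
                                        (smp t x && smp t y)%:R))).
  apply: mean_le => t; case: ltnP => [|_]; last first.
    by apply: sumr_ge0 => x _; apply: sumr_ge0 => y _.
  rewrite /hits => /card_gt1P[x [y []]].
  rewrite !inE => /andP[xN tx] /andP[yN ty] xy.
  rewrite (bigD1 x) //= (bigD1 y) /=; last by rewrite yN.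
  rewrite tx ty /= -addrA lerDl addr_ge0 ?sumr_ge0 //.
  by move=> z _; apply: sumr_ge0.
rewrite mean_sum (le_trans (y := \sum_(x in N) (#|N|%:R * Q%:R^-1 ^+ 2))) //.
  apply: ler_sum => x xN; rewrite mean_sum.
  rewrite (eq_bigr (fun=> Q%:R^-1 ^+ 2)) => [|y /andP[yN xy]].
    rewrite sumr_const -[leLHS]mulr_natl ler_wpM2r ?exprn_ge0 ?invr_ge0 //.
    by rewrite ler_nat; apply/subset_leq_card/subsetP => y /andP[].
  by rewrite mean_sampler2 ?sN.
by rewrite sumr_const -[leLHS]mulr_natl mulrA -expr2 -exprMn.
Qed.

(** Chebyshev: the number of hits has mean mu and variance at most mu, and for mu >= 2 at most one
    hit is a deviation of at least mu/2. For mu < 2 the bound 4/mu exceeds 1. *)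
Lemma prob_hits_le1 (N : {set X}) :
  (0 < #|Om|)%N -> (1 < k)%N -> N \subset dom -> (0 < #|N|)%N ->
  mean (fun t => (hits N t <= 1)%N%:R) <= 4 * Q%:R / #|N|%:R :> R.
Proof.
move=> Om0 k1 sN N0; set mu : R := #|N|%:R / Q%:R.
have mu0 : 0 < mu by rewrite divr_gt0 ?ltr0n.
have -> : 4 * Q%:R / #|N|%:R = 4 / mu by rewrite /mu invf_div mulrA.
have [mu2 | mu2] := ltP mu 2.
  apply: (@le_trans _ _ 1).
    rewrite -[leRHS](@mean_const R Om) //.
    by apply: mean_le => t; case: (_ <= _)%N.
  by rewrite ler_pdivlMr // mul1r (le_trans (ltW mu2)) // ler_nat.
have var : mean (fun t => ((hits N t)%:R - mu) ^+ 2) <= mu.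
  have := @sampled_sum_variance X N (fun=> Q%:R^-1) (fun x => [set x]) Om0.
  have e1 x : x \in N -> [set x] \subset dom by move=> xN; rewrite sub1set (subsetP sN).
  have e2 x : x \in N -> (#|[set x]|.*2 <= k)%N by rewrite cards1.
  move=> /(_ e1 e2) var.
  rewrite [leLHS](_ : _ = \sum_(x in N) \sum_(y in N)
      Q%:R^-1 * Q%:R^-1 * (Q%:R ^+ #|[set x] :&: [set y]| - 1)).
    rewrite (le_trans (y := \sum_(x in N) Q%:R^-1)) //; last first.
      by rewrite sumr_const -[leLHS]mulr_natl.
    apply: ler_sum => x xN; rewrite (bigD1 x) //= big1 => [|y /andP[yN yx]].
      rewrite setIid cards1 expr1 addr0 -mulrA ler_piMr ?invr_ge0 //.
      by rewrite mulrBr mulVf // gerBl mulr1 invr_ge0.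
    rewrite (_ : _ :&: _ = set0) ?cards0 ?expr0 ?subrr ?mulr0 //.
    by apply/setP => z; rewrite !inE; apply/negP => /andP[/eqP-> /eqP xy];
       rewrite xy eqxx in yx.
  rewrite -var; apply: eq_mean => t; rewrite sumr_const -(mulr_natl Q%:R^-1).
  congr ((_ - _) ^+ 2); rewrite hitsE; apply: eq_bigr => x _.
  by rewrite /inv_weight cards1 big_set1 expr1 mulrA mulVf ?mul1r.
have hm : mu ^+ 2 / 4 * mean (fun t => (hits N t <= 1)%N%:R) <= mu.
  apply: le_trans var; rewrite -meanZ; apply: mean_le => t.
  case: leqP => [h1|_]; last by rewrite mulr0 sqr_ge0.
  have {}h1 : (hits N t)%:R <= 1 :> R by rewrite (ler_nat _ _ 1).
  rewrite mulr1; nra.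
rewrite ler_pdivlMr // -(ler_pM2r mu0); lra.
Qed.

End Sampler.


(** * Polynomial hash functions over a finite field *)

Section PolynomialHash.
Variable F : finFieldType.

Definition hash_seed := {ffun 'I_6 -> F}.

Definition hash (a : hash_seed) (x : F) : F := \sum_(i < 6) a i * x ^+ i.

(** The difference of two seeds with equal values is a polynomial of degree below 6 with six
    distinct roots, hence zero. *)
Lemma hash_eval_inj (us : 6.-tuple F) :
  uniq us -> injective (fun a : hash_seed => [ffun j => hash a (tnth us j)]).
Proof.
move=> uus a b /ffunP eq_ab.
pose p := \poly_(i < 6) (a (inord i) - b (inord i)).
have root_p : all (root p) us.
  apply/allP => x /tnthP[j ->]; move: (eq_ab j); rewrite !ffunE /root => eq_j.
  rewrite horner_poly; under eq_bigr do rewrite inord_val mulrBl.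
  by rewrite sumrB -/(hash a _) -/(hash b _) eq_j subrr.
have p0 : p = 0.
  apply/eqP; apply: contraT => /max_poly_roots /(_ root_p uus).
  by rewrite size_tuple ltnNge size_poly.
apply/ffunP => i; apply/eqP; rewrite -subr_eq0.
by have := coef_poly 6 (fun i => a (inord i) - b (inord i)) i;
   rewrite -/p p0 coef0 ltn_ord inord_val => <-.
Qed.

(** Once [A] is completed to six points, evaluation is a bijection on seeds, so the tuples of hash
    values occur exactly once each and the count is that of a product set. *)
Lemma card_hash (A D : {set F}) :
  (6 <= #|F|)%N -> (#|A| <= 6)%N ->
  (#|[set a | [forall x in A, hash a x \in D]]| * #|F| ^ #|A|
   = #|D| ^ #|A| * #|F| ^ 6)%N.
Proof.
move=> F6 A6; pose s := enum A ++ take (6 - #|A|) (enum (~: A)).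
have size_s : size s == 6%N.
  rewrite size_cat size_take -!cardE; have := cardsC A.
  move=> cA; have {}F6 : (6 <= #|A| + #|~: A|)%N by rewrite cA.
  by case: ltnP => h; apply/eqP; lia.
have uniq_s : uniq s.
  rewrite cat_uniq enum_uniq take_uniq ?enum_uniq // andbT /=.
  by apply/hasPn => x /mem_take; rewrite !mem_enum inE.
pose us := Tuple size_s; have uniq_us : uniq us by [].
pose ev (a : hash_seed) : hash_seed := [ffun j => hash a (tnth us j)].
have ev_bij : bijective ev := injF_bij (hash_eval_inj uniq_us).
pose J := [set j | tnth us j \in A].
have cardJ : #|J| = #|A|.
  have -> : A = [set tnth us j | j in J].
    apply/setP => x; apply/idP/imsetP => [xA | [j]]; last by rewrite inE => ? ->.
    have /tnthP[j xj] : x \in us by rewrite mem_cat mem_enum xA.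
    by exists j; rewrite // inE -xj.
  by rewrite card_imset //; apply/tuple_uniqP.
pose G (j : 'I_6) : pred F := fun x => (j \in J) ==> (x \in D).
have -> : [set a | [forall x in A, hash a x \in D]]
    = ev @^-1: [set b | b \in family G].
  apply/setP => a; rewrite !inE; apply/forall_inP/familyP => [hA j | hJ x xA].
    rewrite /G !inE ffunE; apply/implyP => jA; exact: hA.
  have /tnthP[j xj] : x \in us by rewrite mem_cat mem_enum xA.
  by move: (hJ j); rewrite /G !inE -xj xA ffunE -xj.
rewrite (on_card_preimset (onW_bij _ ev_bij)) cardsE card_family foldrE.
rewrite big_map big_enum /= (bigID (mem J)) /=.
rewrite (eq_bigr (fun=> #|D|)) => [|j jJ]; last first.
  by apply: eq_card => x; rewrite -[LHS]/(G j x) /G jJ.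
rewrite [X in (_ * X * _)%N](eq_bigr (fun=> #|F|)) => [|j /negbTE jJ]; last first.
  by apply: eq_card => x; rewrite -[LHS]/(G j x) /G jJ.
rewrite !prod_nat_const cardJ -mulnA; congr (_ * _)%N; rewrite -expnD.
congr (_ ^ _)%N; rewrite -cardJ addnC.
have <- : #|~: J| = #|[predC J]| by apply: eq_card => j; rewrite !inE.
by rewrite cardsC card_ord.
Qed.

(** A hash value is uniform on the field, so it falls in [D] with probability #|D| / #|F|. An exact
    rate 1/Q asks that Q divide #|F|, which is why rates and field order are powers of 2. *)
Lemma hash_sampler (R : realType) (X : finType) (dom : {set X})
    (emb : X -> F) (D : {set F}) (Q : nat) :
  {in dom &, injective emb} -> (6 <= #|F|)%N -> (#|D| * Q = #|F|)%N ->
  sampler R dom 6 Q (fun (a : hash_seed) x => hash a (emb x) \in D).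
Proof.
move=> emb_inj F6 DQ A sA A6.
have cA : #|emb @: A| = #|A|.
  by apply: card_in_imset => x y xA yA; apply: emb_inj; apply: (subsetP sA).
have F0 : (0 < #|F|)%N by apply: leq_trans F6.
have Q0 : (0 < Q)%N by move: F0; rewrite -DQ muln_gt0 => /andP[].
rewrite /mean card_ffun card_ord.
have -> : \sum_(t : hash_seed) \prod_(x in A) (hash t (emb x) \in D)%:R
  = #|[set a | [forall x in emb @: A, hash a x \in D]]|%:R :> R.
  rewrite -sum1_card natr_sum [RHS]big_mkcond /=; apply: eq_bigr => a _.
  rewrite inE; case: ifP => [/forall_inP h | /forall_inP h].
    by rewrite big1 // => x xA; rewrite h //; apply: imset_f.
  apply/eqP; rewrite prodf_seq_eq0; apply: contra_notT h => /hasPn h x.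
  move=> /imsetP[y yA ->]; have := h y (mem_index_enum _).
  by rewrite yA /=; case: (_ \in D); rewrite ?eqxx.
have h := @card_hash (emb @: A) D F6; rewrite cA in h; move/(_ A6) in h.
rewrite exprVn -[RHS]mul1r; apply/eqP.
rewrite eqr_div ?pnatr_eq0 ?expf_neq0 ?pnatr_eq0 -?lt0n ?expn_gt0 ?F0 //.
rewrite mul1r -natrX -natrM eqr_nat.
rewrite -(eqn_pmul2r (_ : 0 < #|D| ^ #|A|)%N); last first.
  by rewrite expn_gt0; move: F0; rewrite -DQ muln_gt0 => /andP[->].
by rewrite -mulnA -expnMn [(Q * _)%N]mulnC DQ h mulnC.
Qed.

Lemma exists_set_card (d : nat) : (d <= #|F|)%N -> {D : {set F} | #|D| = d}.
Proof.
move=> dF; exists [set x in take d (enum F)]; rewrite cardsE.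
by rewrite (card_uniqP _) ?take_uniq ?enum_uniq // size_takel // -cardE.
Qed.

End PolynomialHash.


(** * Four-cycles listed from their last edge *)

Lemma eq_set2 (V : finType) (a b c d : V) :
  ([set a; b] == [set c; d])
  = (a == c) && (b == d) || (a == d) && (b == c).
Proof.
apply/eqP/idP => [/setP h | /orP[]/andP[/eqP-> /eqP->] //]; last exact: setUC.
move: (h a) (h b) (h c) (h d); rewrite !inE !eqxx ?orbT /=.
rewrite (eq_sym c a) (eq_sym c b) (eq_sym d a) (eq_sym d b).
by case: (a == c); case: (a == d); case: (b == c); case: (b == d).
Qed.

Ltac vertex_cases :=
  repeat match goal with
  | H : is_true (~~ (?a == ?a)) |- _ => by rewrite eqxx in H
  | H : is_true (_ && _) |- _ => move/andP: H => []; intros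
  | H : is_true (_ || _) |- _ => move/orP: H => []; intros
  | H : is_true (?a == ?b) |- _ => move/eqP: H => H; subst
  end.

Section Quads.
Variables (V : finType) (G : sgraph V) (s : seq {set V}).
Hypothesis s_edges : s =i edges G.

Definition quad := (V * V * V * V)%type.

Definition cycle_of (q : quad) : {set {set V}} :=
  let: (x, y, z, w) := q in cycle4_edges x y z w.

Definition closed4 (q : quad) : bool :=
  let: (x, y, z, w) := q in
  [&& uniq [:: x; y; z; w], adj G x y, adj G y z, adj G z w & adj G w x].

Arguments closed4 : simpl never.

Definition qtime (q : quad) : nat :=
  let: (x, y, z, w) := q in index [set x; y] s.

Definition first3 (q : quad) : seq {set V} :=
  let: (x, y, z, w) := q in [:: [set y; z]; [set z; w]; [set w; x]].

(** A cycle is listed as a traversal x, y, z, w whose edge xy arrives last. Of its eight traversals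
    this leaves two, which differ by swapping x with y and z with w and so exchange the diagonals xz
    and yw. *)
Definition lastq : {set quad} :=
  [set q | closed4 q & all (fun e => index e s < qtime q)%N (first3 q)].

Lemma mem_edges (x y : V) : ([set x; y] \in edges G) = adj G x y.
Proof.
apply/imsetP/idP => [[[a b]] | xy]; last by exists (x, y); rewrite ?inE.
rewrite inE /= => ab /eqP; rewrite eq_set2 => /orP[]/andP[/eqP-> /eqP->] //.
by rewrite adj_sym.
Qed.

Lemma mem_stream (x y : V) : ([set x; y] \in s) = adj G x y.
Proof. by rewrite s_edges mem_edges. Qed.

Lemma stream_time_inj (e f : {set V}) :
  e \in s -> f \in s -> index e s = index f s -> e = f.
Proof. by move=> es fs; apply: index_inj. Qed.

Lemma closed4_rot (x y z w : V) : closed4 (x, y, z, w) = closed4 (y, z, w, x).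
Proof.
rewrite /closed4 -[[:: y; z; w; x]]/(rot 1 [:: x; y; z; w]) rot_uniq.
by case: uniq => //=; case: adj; rewrite ?andbT ?andbF.
Qed.

Lemma cycle_of_rot (x y z w : V) : cycle_of (x, y, z, w) = cycle_of (y, z, w, x).
Proof.
apply/setP => e; rewrite /= /cycle4_edges !inE.
by do 4 case: (e == _).
Qed.

Lemma cycle_of_flip (x y z w : V) : cycle_of (x, y, z, w) = cycle_of (y, x, w, z).
Proof.
apply/setP => e; rewrite /= /cycle4_edges !inE [[set y; x]]setUC.
rewrite [[set x; w]]setUC [[set w; z]]setUC [[set z; y]]setUC.
by do 4 case: (e == _).
Qed.

Lemma closed4_neq (x y z w : V) : closed4 (x, y, z, w) ->
  [&& x != y, x != z, x != w, y != z, y != w & z != w].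
Proof.
by rewrite /closed4 /= !inE !negb_or => /andP[] /and4P[/and3P[-> -> ->] /andP[-> ->] ->].
Qed.

Lemma closed4_adj (x y z w : V) : closed4 (x, y, z, w) ->
  [&& adj G x y, adj G y z, adj G z w & adj G w x].
Proof. by rewrite /closed4 => /andP[]. Qed.

(** The four edges of a cycle have pairwise distinct arrival times, so some rotation starts with the
    latest. *)
Lemma closed4_last (x y z w : V) : closed4 (x, y, z, w) ->
  [|| (x, y, z, w) \in lastq, (y, z, w, x) \in lastq,
      (z, w, x, y) \in lastq | (w, x, y, z) \in lastq].
Proof.
move=> cq.
have cq1 := cq; rewrite closed4_rot in cq1.
have cq2 := cq1; rewrite closed4_rot in cq2.
have cq3 := cq2; rewrite closed4_rot in cq3.
rewrite !inE cq cq1 cq2 cq3 !andTb /= !andbT.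
have /and4P[xy yz zw wx] := closed4_adj cq.
rewrite -!mem_stream in xy yz zw wx.
have n1 : index [set x; y] s != index [set y; z] s.
  apply/negP => /eqP /(stream_time_inj xy yz) /eqP; rewrite eq_set2 => ?.
  by have ? := closed4_neq cq; vertex_cases.
have n2 : index [set x; y] s != index [set z; w] s.
  apply/negP => /eqP /(stream_time_inj xy zw) /eqP; rewrite eq_set2 => ?.
  by have ? := closed4_neq cq; vertex_cases.
have n3 : index [set x; y] s != index [set w; x] s.
  apply/negP => /eqP /(stream_time_inj xy wx) /eqP; rewrite eq_set2 => ?.
  by have ? := closed4_neq cq; vertex_cases.
have n4 : index [set y; z] s != index [set z; w] s.
  apply/negP => /eqP /(stream_time_inj yz zw) /eqP; rewrite eq_set2 => ?.
  by have ? := closed4_neq cq; vertex_cases.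
have n5 : index [set y; z] s != index [set w; x] s.
  apply/negP => /eqP /(stream_time_inj yz wx) /eqP; rewrite eq_set2 => ?.
  by have ? := closed4_neq cq; vertex_cases.
have n6 : index [set z; w] s != index [set w; x] s.
  apply/negP => /eqP /(stream_time_inj zw wx) /eqP; rewrite eq_set2 => ?.
  by have ? := closed4_neq cq; vertex_cases.
lia.
Qed.

Lemma lastq_closed (q : quad) : q \in lastq -> closed4 q.
Proof. by rewrite inE => /andP[]. Qed.

Lemma mem_four_cycles (q : quad) : closed4 q -> cycle_of q \in four_cycles G.
Proof.
case: q => [[[x y] z] w] cq; rewrite inE.
apply/existsP; exists x; apply/existsP; exists y.
apply/existsP; exists z; apply/existsP; exists w.
by move: cq; rewrite /closed4 => /and5P[-> -> -> -> ->] /=.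
Qed.

Lemma four_cyclesP (C : {set {set V}}) : C \in four_cycles G ->
  exists2 q, q \in lastq & cycle_of q = C.
Proof.
rewrite inE => /existsP[x /existsP[y /existsP[z /existsP[w]]]].
move=> /and5P[u xy yz zw /andP[wx /eqP->]].
have cq : closed4 (x, y, z, w) by rewrite /closed4 u xy yz zw wx.
case/or4P: (closed4_last cq) => qL.
- by exists (x, y, z, w).
- by exists (y, z, w, x); rewrite // -cycle_of_rot.
- by exists (z, w, x, y); rewrite // 2!cycle_of_rot.
- by exists (w, x, y, z); rewrite // cycle_of_rot.
Qed.

Lemma lastq_flip (x y z w : V) :
  (x, y, z, w) \in lastq -> (y, x, w, z) \in lastq.
Proof.
rewrite !inE => /andP[cq]; rewrite /= [[set y; x]]setUC.
rewrite [[set x; w]]setUC [[set w; z]]setUC [[set z; y]]setUC.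
move=> /and4P[-> -> -> _]; rewrite !andbT /closed4.
have /and4P[xy yz zw wx] := closed4_adj cq.
rewrite !(adj_sym G y) !(adj_sym G w) xy -(adj_sym G w) wx zw -(adj_sym G y) yz.
have h := closed4_neq cq; rewrite /= !inE !negb_or (eq_sym y x) (eq_sym w z).
by case/and5P: h => -> -> -> -> /andP[-> ->].
Qed.

Lemma index_last (x y z w : V) (e : {set V}) :
  (x, y, z, w) \in lastq -> e \in cycle_of (x, y, z, w) ->
  (e == [set x; y]) || (index e s < index [set x; y] s)%N.
Proof.
rewrite inE /= /cycle4_edges => /andP[_ /and4P[h1 h2 h3 _]].
rewrite !inE -!orbA; case/or4P => /eqP->; rewrite ?eqxx ?h1 ?h2 ?h3 ?orbT //.
Qed.

(** Equal edge sets have the same last edge, so ab and xy agree up to order; the edges bc and da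
    then leave no choice for c and d. *)
Lemma cycle_of_fiber (x y z w : V) (q : quad) :
  (x, y, z, w) \in lastq -> q \in lastq ->
  cycle_of q = cycle_of (x, y, z, w) ->
  q = (x, y, z, w) \/ q = (y, x, w, z).
Proof.
case: q => [[[a b] c] d] q0L qL eqC.
have ab : [set a; b] = [set x; y].
  have h1 : [set a; b] \in cycle_of (x, y, z, w).
    by rewrite -eqC /= /cycle4_edges !inE eqxx.
  have h2 : [set x; y] \in cycle_of (a, b, c, d).
    by rewrite eqC /= /cycle4_edges !inE eqxx.
  have /orP[/eqP //|l1] := index_last q0L h1.
  have /orP[/eqP //|l2] := index_last qL h2.
  by move: (ltn_trans l1 l2); rewrite ltnn.
have bc : [set b; c] \in cycle_of (x, y, z, w).
  by rewrite -eqC /= /cycle4_edges !inE eqxx ?orbT.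
have da : [set d; a] \in cycle_of (x, y, z, w).
  by rewrite -eqC /= /cycle4_edges !inE eqxx ?orbT.
move/eqP: ab; rewrite eq_set2; move: bc da.
rewrite /= /cycle4_edges !inE !eq_set2.
have n0 := closed4_neq (lastq_closed q0L).
have n1 := closed4_neq (lastq_closed qL) => h1 h2 /orP[]/andP[/eqP e1 /eqP e2];
  subst a b; [left | right]; clear -n0 n1 h1 h2; vertex_cases => //.
Qed.

Lemma card_cycle_fiber (C : {set {set V}}) : C \in four_cycles G ->
  #|[set q in lastq | cycle_of q == C]| = 2%N.
Proof.
move=> /four_cyclesP[[[[x y] z] w] qL <-].
have -> : [set q in lastq | cycle_of q == cycle_of (x, y, z, w)]
    = [set (x, y, z, w); (y, x, w, z)].
  apply/setP => q; rewrite [LHS]in_set in_set2.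
  apply/andP/orP => [[qL' /eqP /(cycle_of_fiber qL qL')[]->] |].
  - by left.
  - by right.
  - case=> /eqP->; first by rewrite eqxx.
    by rewrite -cycle_of_flip eqxx lastq_flip.
have /and5P[xy _ _ _ _] := closed4_neq (lastq_closed qL).
by rewrite cards2 !xpair_eqE (negbTE xy).
Qed.

Lemma sum_lastq (f : {set {set V}} -> nat) :
  (\sum_(q in lastq) f (cycle_of q) = 2 * \sum_(C in four_cycles G) f C)%N.
Proof.
rewrite (partition_big cycle_of (mem (four_cycles G))) /=; last first.
  by move=> q /lastq_closed; apply: mem_four_cycles.
rewrite big_distrr /=; apply: eq_bigr => C CG.
rewrite (eq_bigr (fun=> f C)) => [|q /andP[_ /eqP->] //].
rewrite sum_nat_const -(card_cycle_fiber CG); congr (_ * _)%N.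
by apply: eq_card => q; rewrite [RHS]in_set.
Qed.

Lemma card_lastq : #|lastq| = (2 * num_C4 G)%N.
Proof. by rewrite -sum1_card (sum_lastq (fun=> 1%N)) sum1_card. Qed.

Lemma card_lastq_at (e : {set V}) :
  #|[set q in lastq | e \in cycle_of q]| = (2 * num_C4_at G e)%N.
Proof.
have := sum_lastq (fun C => (e \in C) : nat) => h.
rewrite /num_C4_at; transitivity (\sum_(q in lastq) (e \in cycle_of q))%N.
  rewrite -sum1_card [LHS]big_mkcond [RHS]big_mkcond; apply: eq_bigr => q _.
  by rewrite [_ \in [set _ in _ | _]]in_set; do 2 case: (_ \in _).
rewrite h -sum1_card; congr (_ * _)%N.
rewrite [LHS]big_mkcond [RHS]big_mkcond; apply: eq_bigr => C _.
by rewrite [_ \in [set _ in _ | _]]in_set; do 2 case: (_ \in _).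
Qed.

(** Every traversal is a rotation of an element of [lastq], and there are four rotations. *)
Lemma card_closed4 : (#|[set q | closed4 q]| <= 8 * num_C4 G)%N.
Proof.
pose r (q : quad) : quad := let: (x, y, z, w) := q in (y, z, w, x).
have sub : [set q | closed4 q] \subset
    lastq :|: [set r q | q in lastq] :|: [set r (r q) | q in lastq]
    :|: [set r (r (r q)) | q in lastq].
  apply/subsetP => -[[[x y] z] w]; rewrite in_set => /closed4_last.
  rewrite !in_setU; case/or4P => qL.
  - by rewrite qL.
  - suff -> : (x, y, z, w) \in [set r (r (r q)) | q in lastq] by rewrite !orbT.
    by apply/imsetP; exists (y, z, w, x).
  - suff -> : (x, y, z, w) \in [set r (r q) | q in lastq] by rewrite !orbT.
    by apply/imsetP; exists (z, w, x, y).
  - suff -> : (x, y, z, w) \in [set r q | q in lastq] by rewrite !orbT.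
    by apply/imsetP; exists (w, x, y, z).
apply: leq_trans (subset_leq_card sub) _.
have U (A B : {set quad}) : (#|A :|: B| <= #|A| + #|B|)%N.
  exact: leq_of_leqif (leq_card_setU A B).
have I (f : quad -> quad) : (#|f @: lastq| <= #|lastq|)%N := leq_imset_card f _.
rewrite (_ : 8 = 4 * 2)%N // -mulnA -card_lastq.
have -> : (4 * #|lastq| = #|lastq| + #|lastq| + #|lastq| + #|lastq|)%N by ring.
do 3 (apply: leq_trans (U _ _) _; apply: leq_add (I _)).
exact: leqnn.
Qed.

(** * Diagonals and their common neighbours *)

Definition common_nbrs (x z : V) : {set V} :=
  [set u | adj G x u && adj G u z].

(** The prefix has length [t.+1] so as to include the edge arriving at time [t], which takes part in
    the density test made on its arrival. *)
Definition common_nbrs_at (t : nat) (x z : V) : {set V} :=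
  [set u | ([set x; u] \in take t.+1 s) && ([set u; z] \in take t.+1 s)].

Lemma common_nbrs_at_sub (t : nat) (x z : V) :
  common_nbrs_at t x z \subset common_nbrs x z.
Proof.
by apply/subsetP => u; rewrite !inE => /andP[/mem_take + /mem_take];
   rewrite !mem_stream => -> ->.
Qed.

(** A cycle is viewed as two common neighbours y, w of the ends of its diagonal xz. Every edge of
    the cycle has y or w as an end, so sampling both reveals it. *)
Definition centers (q : quad) : {set V} :=
  let: (x, y, z, w) := q in [set y; w].

Definition codeg (q : quad) : nat :=
  let: (x, y, z, w) := q in #|common_nbrs x z|.

Lemma closed4E (x y z w : V) :
  closed4 (x, y, z, w) = [&& x != z, y != w, y \in common_nbrs x z
                           & w \in common_nbrs x z].
Proof.
rewrite /closed4 /= !inE !negb_or (adj_sym G z w) (adj_sym G w x) -!andbA.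
have neq a b : adj G a b -> a != b.
  by move=> ab; apply/eqP => eab; rewrite eab adj_irr in ab.
case xy : (adj G x y); last by rewrite !andbF.
case yz : (adj G y z); last by rewrite !andbF.
case wz : (adj G w z); last by rewrite !andbF.
case xw : (adj G x w); last by rewrite !andbF.
by rewrite (neq _ _ xy) (neq _ _ yz) (neq _ _ xw) (eq_sym z w) (neq _ _ wz) ?andbT.
Qed.

Lemma sum_diagonal (f : quad -> nat) :
  (\sum_q f q = \sum_(d : V * V) \sum_(c : V * V) f (d.1, c.1, d.2, c.2))%N.
Proof.
rewrite pair_bigA /=.
pose h (p : (V * V) * (V * V)) : quad := (p.1.1, p.2.1, p.1.2, p.2.2).
rewrite (reindex h) //; exists (fun q : quad =>
  let: (x, y, z, w) := q in ((x, z), (y, w))).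
  by move=> [[x z] [y w]].
by move=> [[[x y] z] w].
Qed.

Lemma sum_distinct_pairs (X : {set V}) :
  (\sum_(c : V * V) [&& c.1 != c.2, c.1 \in X & c.2 \in X]
   = #|X| * #|X|.-1)%N.
Proof.
rewrite -(pair_bigA _ (fun y w => [&& y != w, y \in X & w \in X] : nat)) /=.
rewrite -sum_nat_const [RHS]big_mkcond /=; apply: eq_bigr => y _.
case: ifP => yX; last by rewrite big1 // => w _; rewrite andbF.
rewrite (cardsD1 y X) yX add1n /= -sum1_card [RHS]big_mkcond /=.
by apply: eq_bigr => w _; rewrite !inE eq_sym; case: (_ && _).
Qed.

(** For a diagonal with d common neighbours, d(d - 1) counts the ordered choices of two of them, and
    each choice is a closed traversal. *)
Lemma sum_codeg_pairs :
  (\sum_(d : V * V | d.1 != d.2)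
     #|common_nbrs d.1 d.2| * #|common_nbrs d.1 d.2|.-1 <= 8 * num_C4 G)%N.
Proof.
apply: leq_trans card_closed4; rewrite -sum1_card [leqRHS]big_mkcond /=.
rewrite sum_diagonal big_mkcond /=; apply: leq_sum => d _.
case: ifP => // dn; rewrite -sum_distinct_pairs; apply: leq_sum => c _.
by rewrite [(_, _, _, _) \in _]in_set closed4E dn /=; case: (_ && _).
Qed.

(** Localization to one diagonal: the products d(d - 1) over all diagonals sum to at most 8T by
    [sum_codeg_pairs]. *)
Lemma sum_lastq_diagonal (P : quad -> bool) (f : quad -> nat) (k : nat) :
  (forall x z (X := common_nbrs x z), x != z ->
    \sum_(c : V * V | [&& c.1 != c.2, c.1 \in X & c.2 \in X]
         && P (x, c.1, z, c.2)) f (x, c.1, z, c.2) <= k * (#|X| * #|X|.-1))%N ->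
  (\sum_(q in lastq | P q) f q <= 8 * k * num_C4 G)%N.
Proof.
move=> hP; apply: (@leq_trans (\sum_q (closed4 q && P q) * f q)%N).
  rewrite big_mkcond; apply: leq_sum => q _; case: ifP => // /andP[/lastq_closed-> ->].
  by rewrite mul1n.
rewrite sum_diagonal mulnAC mulnC.
apply: leq_trans (leq_mul (leqnn k) sum_codeg_pairs).
rewrite big_distrr [leqRHS]big_mkcond /=; apply: leq_sum => -[x z] _ /=.
case: ifPn => [xz | /negPn/eqP<-]; last first.
  by rewrite big1 // => c _; rewrite closed4E eqxx.
apply: leq_trans (hP x z xz); rewrite [leqRHS]big_mkcond /=; apply: leq_sum => c _.
by rewrite closed4E xz andTb; case: (_ && P _); rewrite ?mul1n.
Qed.

(** If [v] is one of the d common neighbours of a diagonal, 2(d - 1) ordered pairs contain it, each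
    of weight d; otherwise none does. *)
Lemma sum_codeg_center (v : V) :
  (\sum_(q in lastq | v \in centers q) codeg q <= 16 * num_C4 G)%N.
Proof.
apply: (@sum_lastq_diagonal (fun q => v \in centers q) codeg 2) => x z X xz /=.
rewrite sum_nat_const -/X mulnC mulnCA leq_mul2l; apply/orP; right.
have [vX | vX] := boolP (v \in X); last first.
  rewrite eq_card0 // => -[y w]; apply/negP; rewrite unfold_in /= in_set2.
  move=> /andP[/and3P[_ yX wX]] /orP[]/eqP e; subst.
    by rewrite yX in vX.
  by rewrite wX in vX.
have -> : #|X|.-1 = #|X :\ v| by rewrite (cardsD1 v X) vX.
apply: (@leq_trans #|[set (v, u) | u in X :\ v] :|: [set (u, v) | u in X :\ v]|).
  apply/subset_leq_card/subsetP => -[y w]; rewrite unfold_in /= in_set2 in_setU.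
  move=> /andP[/and3P[yw yX wX]] /orP[]/eqP e; subst; apply/orP.
    by left; apply/imsetP; exists w; rewrite // in_setD1 eq_sym yw.
  by right; apply/imsetP; exists y; rewrite // in_setD1 yw.
apply: leq_trans (leq_of_leqif (leq_card_setU _ _)) _.
by rewrite mul2n -addnn leq_add // leq_imset_card.
Qed.

(** A diagonal contributes at most two ordered pairs of weight d^2, and 2d^2 <= 4d(d - 1) because d
    >= 2 whenever a pair exists. *)
Lemma sum_codeg_centers (a b : V) : a != b ->
  (\sum_(q in lastq | centers q == [set a; b]) codeg q ^ 2
   <= 32 * num_C4 G)%N.
Proof.
move=> ab; apply: (@sum_lastq_diagonal (fun q => centers q == [set a; b])
  (fun q => codeg q ^ 2)%N 4) => x z X xz /=.
rewrite sum_nat_const -/X.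
have [/andP[aX bX] | nab] := boolP ((a \in X) && (b \in X)); last first.
  rewrite eq_card0 // => -[y w]; apply/negP; rewrite unfold_in /= eq_set2.
  move=> /andP[/and3P[_ yX wX]] /orP[]/andP[/eqP ? /eqP ?]; subst y w;
    by rewrite yX wX in nab.
have X2 : (1 < #|X|)%N by apply/card_gt1P; exists a, b.
apply: (@leq_trans (#|[set (a, b); (b, a)]| * #|X| ^ 2)%N).
  rewrite leq_mul2r; apply/orP; right; apply/subset_leq_card/subsetP => -[y w].
  rewrite unfold_in /= eq_set2 !inE !xpair_eqE => /andP[_].
  by [].
have : (#|[set (a, b); (b, a)]| <= 2)%N by rewrite cards2; case: (_ != _).
by move: X2; move: #|X| #|[set _; _]| => m k ? ?; nia.
Qed.

(** * Cycles sharing edges *)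

Lemma lastq_edges (x y z w : V) (t : nat) :
  (x, y, z, w) \in lastq -> (index [set x; y] s <= t)%N ->
  [/\ [set x; y] \in take t.+1 s, [set y; z] \in take t.+1 s,
      [set z; w] \in take t.+1 s & [set w; x] \in take t.+1 s].
Proof.
rewrite in_set => /andP[/closed4_adj] /=.
rewrite -!mem_stream => /and4P[xy yz zw wx] /and4P[h1 h2 h3 _] xyt.
by rewrite !in_take // !ltnS xyt !(leq_trans _ xyt) // ltnW.
Qed.

Lemma common_nbrs_atC (t : nat) (x z : V) :
  common_nbrs_at t x z = common_nbrs_at t z x.
Proof.
by apply/setP => u; rewrite !inE andbC [[set u; z]]setUC [[set x; u]]setUC.
Qed.

(** The fourth vertex u of such a cycle is a common neighbour of [a] and [b] by time [t]. The last
    edge is ua or ub, in either orientation, which gives four families indexed by u. *)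
Lemma card_wedge_lastq (a b c : V) (t : nat) :
  a != b -> a != c -> b != c ->
  (#|[set q in lastq | [&& (qtime q <= t)%N, [set a; c] \in first3 q
                         & [set c; b] \in first3 q]]|
   <= 4 * #|common_nbrs_at t a b|)%N.
Proof.
move=> ab ac bc; set X := common_nbrs_at t a b.
have sub : [set q in lastq | [&& (qtime q <= t)%N, [set a; c] \in first3 q
                         & [set c; b] \in first3 q]] \subset
    [set (u, a, c, b) | u in X] :|: [set (u, b, c, a) | u in X]
    :|: [set (b, u, a, c) | u in X] :|: [set (a, u, b, c) | u in X].
  apply/subsetP => -[[[x y] z] w]; rewrite !in_setU in_set.
  move=> /andP[qL /and3P[qt]]; have [t1 t2 t3 t4] := lastq_edges qL qt.
  have hx : x \in common_nbrs_at t y w by rewrite in_set [[set y; x]]setUC t1 setUC.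
  have hy : y \in common_nbrs_at t x z by rewrite in_set t1.
  have n := closed4_neq (lastq_closed qL).
  rewrite /= !inE !eq_set2 => h1 h2.
  clear -ab ac bc n h1 h2 hx hy X.
  vertex_cases; rewrite -!orbA; apply/or4P; first
    [ by apply: Or41; apply/imsetP; exists x
    | by apply: Or42; apply/imsetP; exists x; rewrite // /X common_nbrs_atC
    | by apply: Or43; apply/imsetP; exists y; rewrite // /X common_nbrs_atC
    | by apply: Or44; apply/imsetP; exists y ].
apply: leq_trans (subset_leq_card sub) _.
have U (A B : {set quad}) : (#|A :|: B| <= #|A| + #|B|)%N.
  exact: leq_of_leqif (leq_card_setU A B).
have I (f : V -> quad) : (#|f @: X| <= #|X|)%N := leq_imset_card f _.
have -> : (4 * #|X| = #|X| + #|X| + #|X| + #|X|)%N by ring.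
do 3 (apply: leq_trans (U _ _) _; apply: leq_add (I _)); exact: I.
Qed.

(** Two disjoint edges contain all four vertices, and the last edge joins an end of one to an end of
    the other: eight traversals, listed in [L]. *)
Lemma card_opposite_lastq (a b c d : V) :
  [&& a != b, a != c, a != d, b != c, b != d & c != d] ->
  (#|[set q in lastq | ([set a; b] \in first3 q) && ([set c; d] \in first3 q)]|
   <= 8)%N.
Proof.
move=> n0.
pose L : seq quad := [:: (d, a, b, c); (c, a, b, d); (d, b, a, c); (c, b, a, d);
                         (b, c, d, a); (a, c, d, b); (b, d, c, a); (a, d, c, b)].
apply: (@leq_trans #|L|); last exact: card_size.
apply/subset_leq_card/subsetP => -[[[x y] z] w]; rewrite in_set => /andP[qL].
have n := closed4_neq (lastq_closed qL).
rewrite /= !inE !eq_set2 !xpair_eqE => /andP[h1 h2].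
clear -n0 n h1 h2; vertex_cases; by rewrite !eqxx /= ?orbT.
Qed.

Definition wedge1 (q q' : quad) : bool :=
  let: (x, y, z, w) := q in
  ([set y; z] \in first3 q') && ([set z; w] \in first3 q').

Definition wedge2 (q q' : quad) : bool :=
  let: (x, y, z, w) := q in
  ([set z; w] \in first3 q') && ([set w; x] \in first3 q').

Definition opposite (q q' : quad) : bool :=
  let: (x, y, z, w) := q in
  ([set y; z] \in first3 q') && ([set w; x] \in first3 q').

Lemma first3_uniq (q : quad) : closed4 q -> uniq (first3 q).
Proof.
case: q => [[[x y] z] w] /closed4_neq n; rewrite /= !inE !eq_set2.
apply/and3P; split=> //; apply/negP => h; clear -n h; vertex_cases.
Qed.

(** The first three edges form a path. Two shared edges are a wedge or the two outer edges, and
    three shared edges include the outer pair, so the cubic term is needed only with [opposite]. *)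
Lemma expn_card_shared (Q : nat) (q q' : quad) (B : {set {set V}}) :
  (0 < Q)%N -> closed4 q -> {subset B <= first3 q} -> {subset B <= first3 q'} ->
  (Q ^ #|B| <= 1 + Q * #|B| + Q ^ 2 * (wedge1 q q' + wedge2 q q')
               + Q ^ 3 * opposite q q')%N.
Proof.
move=> Q0 cq sB sB'.
have -> : #|B| = count (mem B) (first3 q).
  rewrite -size_filter -(card_uniqP (filter_uniq (mem B) (first3_uniq cq))).
  apply: eq_card => e; rewrite mem_filter /=; case eB : (e \in B) => //=.
  by rewrite sB.
case: q cq {sB} => [[[x y] z] w] cq /=.
move: (sB' [set y; z]) (sB' [set z; w]) (sB' [set w; x]).
case: (_ \in B) => [/(_ isT)->|_]; case: (_ \in B) => [/(_ isT)->|_];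
  case: (_ \in B) => [/(_ isT)->|_]; rewrite /= ?andbT; try lia.
all: rewrite ?expn1 ?expn0; try nia.
Qed.

End Quads.


(** * Variance of the two partial estimators *)

Section Variance.
Variables (R : realType) (V : finType) (G : sgraph V) (s : seq {set V}).
Hypothesis s_edges : s =i edges G.
Variable heavy : {set V} -> bool.
Variables (Q Q' : nat).
Hypothesis Q_gt0 : (0 < Q)%N.
Hypothesis Q'_gt0 : (0 < Q')%N.
Hypothesis heavyP : perfect_oracle G (Q'%:R : R) heavy.
Variables (Oe Ov Ow : finType).
Variables (smpE : Oe -> {set V} -> bool) (smpV : Ov -> V -> bool).
Variable smpW : Ow -> V -> bool.
Hypothesis smpEP : sampler R (edges G) 6 Q smpE.
Hypothesis smpVP : sampler R [set: V] 6 Q smpV.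
Hypothesis smpWP : sampler R [set: V] 6 Q' smpW.
Hypothesis Oe_gt0 : (0 < #|Oe|)%N.
Hypothesis Ov_gt0 : (0 < #|Ov|)%N.
Hypothesis Ow_gt0 : (0 < #|Ow|)%N.

Local Notation lastq := (lastq G s).
Local Notation T := (num_C4 G).

Definition dense (om : Ow) (t : nat) (x z : V) : bool :=
  (1 < hits smpW (common_nbrs_at s t x z) om)%N.

Definition dense_diag (om : Ow) (q : quad V) : bool :=
  let: (x, y, z, w) := q in dense om (qtime s q) x z.

Definition dense_codiag (om : Ow) (q : quad V) : bool :=
  let: (x, y, z, w) := q in dense om (qtime s q) y w.

Definition sparse (om : Ow) (q : quad V) : bool :=
  ~~ dense_diag om q && ~~ dense_codiag om q.

(** Heavy edges are stored with certainty, so only light ones enter the inverse weight. *)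
Definition light3 (q : quad V) : {set {set V}} :=
  [set e in first3 q | ~~ heavy e].

(* Each cycle occurs twice in [lastq], with its diagonals exchanged, so the two
   halves of a sparse cycle and the shares of its dense diagonals add up to 1. *)
Definition sparse_coef (om : Ow) (q : quad V) : R := (sparse om q)%:R / 2.

Definition dense_coef (om : Ow) (q : quad V) : R :=
  (dense_diag om q)%:R * (if dense_codiag om q then 2^-1 else 1).

Definition sparse_est (oe : Oe) (om : Ow) : R :=
  \sum_(q in lastq) sparse_coef om q * inv_weight R Q smpE (light3 q) oe.

Definition dense_est (ov : Ov) (om : Ow) : R :=
  \sum_(q in lastq) dense_coef om q * inv_weight R Q smpV (centers q) ov.

Definition flip (q : quad V) : quad V :=
  let: (x, y, z, w) := q in (y, x, w, z).

Lemma coef_flip (om : Ow) (q : quad V) :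
  sparse_coef om q + dense_coef om q
  + (sparse_coef om (flip q) + dense_coef om (flip q)) = 1.
Proof.
case: q => [[[x y] z] w].
rewrite /sparse_coef /dense_coef /sparse /= [[set y; x]]setUC.
rewrite /dense.
by case: (1 < _)%N; case: (1 < _)%N => /=; lra.
Qed.

Lemma sum_coef (om : Ow) :
  \sum_(q in lastq) sparse_coef om q + \sum_(q in lastq) dense_coef om q
  = T%:R.
Proof.
rewrite -big_split /=; pose f q := sparse_coef om q + dense_coef om q.
rewrite (eq_bigr f) //.
have fK : involutive flip by move=> [[[x y] z] w].
have e : \sum_(q in lastq) f q = \sum_(q in lastq) f (flip q).
  rewrite (reindex flip) /=; last by exists flip => q _; apply: fK.
  apply: eq_bigl => q; apply/idP/idP; move: q => [[[x y] z] w];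
  exact: lastq_flip.
have : \sum_(q in lastq) f q + \sum_(q in lastq) f (flip q) = (2 * T)%:R.
  rewrite -big_split /= (eq_bigr (fun=> 1)) => [|q _]; last exact: coef_flip.
  by rewrite sumr_const card_lastq.
by rewrite -e natrM; lra.
Qed.

Lemma lastq_edge_graph (q : quad V) (e : {set V}) :
  q \in lastq -> e \in first3 q -> e \in edges G.
Proof.
case: q => [[[x y] z] w] /lastq_closed/closed4_adj/and4P[xy yz zw wx].
by rewrite /= !inE => /or3P[]/eqP->; rewrite mem_edges.
Qed.

Lemma first3_cycle (q : quad V) (e : {set V}) :
  e \in first3 q -> e \in cycle_of q.
Proof.
case: q => [[[x y] z] w]; rewrite /= /cycle4_edges !inE.
by move=> /or3P[]->; rewrite ?orbT.
Qed.

Lemma light3_sub (q : quad V) : q \in lastq -> light3 q \subset edges G.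
Proof.
by move=> qL; apply/subsetP => e; rewrite in_set => /andP[/(lastq_edge_graph qL)].
Qed.

Lemma card_light3 (q : quad V) : (#|light3 q| <= 3)%N.
Proof.
apply: (@leq_trans #|first3 q|).
  by apply/subset_leq_card/subsetP => e; rewrite in_set => /andP[].
by apply: leq_trans (card_size _) _; move: q => [[[x y] z] w].
Qed.

(** A light edge is on fewer than T/Q' cycles, hence in at most 2T/Q' listed ones; each of the 2T
    listed cycles has at most three light edges. *)
Lemma sum_light3_shared :
  \sum_(q in lastq) \sum_(q' in lastq) #|light3 q :&: light3 q'|%:R
  <= 12 * T%:R ^+ 2 / Q'%:R :> R.
Proof.
pose n e := \sum_(q in lastq) (e \in light3 q)%:R : R.
have nT e : e \in edges G -> n e <= 2 * T%:R / Q'%:R.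
  move=> eG; have [he | /negP he] := boolP (heavy e).
    rewrite /n big1 ?divr_ge0 ?mulr_ge0 // => q _.
    by rewrite in_set he andbF.
  have : n e <= (2 * num_C4_at G e)%:R.
    rewrite -(card_lastq_at s_edges) -sum1_card natr_sum /n big_mkcond.
    rewrite [leRHS]big_mkcond /=; apply: ler_sum => q _.
    rewrite [q \in [set _ in _ | _]]in_set; case: (q \in lastq) => //=.
    rewrite in_set; case e3 : (e \in first3 q) => /=.
      by rewrite first3_cycle //; case: (heavy e).
    by case: (_ \in _).
  move/le_trans; apply; rewrite natrM -mulrA ler_pM2l //.
  by apply: ltW; rewrite ltNge -heavyP //; apply/negP.
have -> : \sum_(q in lastq) \sum_(q' in lastq) #|light3 q :&: light3 q'|%:R
    = \sum_(q in lastq) \sum_(e in light3 q) n e.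
  apply: eq_bigr => q _; rewrite exchange_big /=; apply: eq_bigr => q' _.
  rewrite -sum1_card natr_sum big_mkcond [RHS]big_mkcond /=.
  by apply: eq_bigr => e _; rewrite in_setI; do 2 case: (_ \in _).
apply: (@le_trans _ _ (\sum_(q in lastq) 3 * (2 * T%:R / Q'%:R))).
  apply: ler_sum => q qL.
  apply: (@le_trans _ _ (\sum_(e in light3 q) 2 * T%:R / Q'%:R)).
    by apply: ler_sum => e /(subsetP (light3_sub qL)) /nT.
  rewrite sumr_const -[leLHS]mulr_natl ler_wpM2r ?divr_ge0 ?mulr_ge0 //.
  by rewrite ler_nat card_light3.
rewrite sumr_const -[leLHS]mulr_natl (card_lastq s_edges) natrM.
by rewrite le_eqVlt; apply/orP; left; apply/eqP; ring.
Qed.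

(** A product rather than a quotient, so that zero common neighbours need no exception; the factor
    4d is the bound of [card_wedge_lastq]. *)
Lemma prob_not_dense (t : nat) (x z : V) :
  mean (fun om => (~~ dense om t x z)%:R)
    * (4 * #|common_nbrs_at s t x z|)%:R <= 16 * Q'%:R :> R.
Proof.
have [->|n0] := posnP #|common_nbrs_at s t x z|.
  by rewrite muln0 mulr0 mulr_ge0.
have := prob_hits_le1 smpWP Q'_gt0 Ow_gt0 isT (subsetT _) n0.
rewrite ler_pdivlMr ?ltr0n // natrM => h.
rewrite (eq_mean (g := fun om => (hits smpW (common_nbrs_at s t x z) om <= 1)%N%:R)).
  lra.
by move=> om; rewrite /dense -leqNgt.
Qed.

(** Orders each pair so that the first index is the later one. Ties are counted twice, which is
    harmless for nonnegative terms. *)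
Lemma sum_pairs_sym (I : finType) (J : {set I}) (f : I -> I -> R) (t : I -> nat) :
  (forall i j, f i j = f j i) -> (forall i j, 0 <= f i j) ->
  \sum_(i in J) \sum_(j in J) f i j
  <= 2 * \sum_(i in J) \sum_(j in J | (t j <= t i)%N) f i j.
Proof.
move=> fC f0.
have -> : \sum_(i in J) \sum_(j in J) f i j
  = \sum_(i in J) \sum_(j in J | (t j <= t i)%N) f i j
    + \sum_(i in J) \sum_(j in J | ~~ (t j <= t i)%N) f i j.
  by rewrite -big_split /=; apply: eq_bigr => i _; rewrite -bigID.
rewrite mulr_natl mulr2n lerD2l.
rewrite [leRHS](exchange_big_dep (mem J)) /=; last by move=> i j _ /andP[].
apply: ler_sum => i iJ.
rewrite big_mkcond [leRHS]big_mkcond; apply: ler_sum => j _ /=.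
rewrite -ltnNge iJ; case: (j \in J) => //=.
by case: ltngtP => //= _; rewrite fC.
Qed.

(* In each pair of cycles let [q] be the one completed last.  A wedge of [q] is then
   shared with at most 4d earlier cycles, where d counts the common neighbours of
   its ends at that time, while [q] is sparse with probability at most 4Q'/d. *)
Lemma sparse_variance :
  mean (fun om => mean (fun oe =>
    (sparse_est oe om - \sum_(q in lastq) sparse_coef om q) ^+ 2))
  <= 6 * Q%:R * T%:R ^+ 2 / Q'%:R + 32 * Q%:R ^+ 2 * Q'%:R * T%:R
     + 8 * Q%:R ^+ 3 * T%:R.
Proof.
pose w12 (q q' : quad V) := (wedge1 q q' + wedge2 q q')%N.
pose later q q' := (qtime s q' <= qtime s q)%N.
pose bound om q := Q%:R * \sum_(q' in lastq) #|light3 q :&: light3 q'|%:R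
  + Q%:R ^+ 2 * ((sparse om q)%:R * \sum_(q' in lastq | later q q') (w12 q q')%:R)
  + Q%:R ^+ 3 * 8 : R.
have step1 om : mean (fun oe =>
    (sparse_est oe om - \sum_(q in lastq) sparse_coef om q) ^+ 2)
    <= 2^-1 * \sum_(q in lastq) bound om q.
  rewrite (sampled_sum_variance smpEP) //; first last.
  - by move=> q _; have := card_light3 q; rewrite -leq_double.
  - exact: light3_sub.
  pose f q q' : R := sparse_coef om q * sparse_coef om q' *
    (Q%:R ^+ #|light3 q :&: light3 q'| - 1).
  have Q1 k : 1 <= Q%:R ^+ k :> R by rewrite -natrX ler1n expn_gt0 Q_gt0.
  have c0 q : 0 <= sparse_coef om q by rewrite divr_ge0.
  apply: le_trans (@sum_pairs_sym _ lastq f (qtime s) _ _) _.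
  - by move=> i j; rewrite /f setIC [sparse_coef om i * _]mulrC.
  - by move=> i j; apply: mulr_ge0; [apply: mulr_ge0 | rewrite subr_ge0].
  rewrite !mulr_sumr; apply: ler_sum => q qL; rewrite /bound.
  (* Each coefficient is at most 1/2, whence the factor 1/4. The sparsity of [q] is retained only in
     the wedge term. *)
  have h q' : q' \in lastq -> f q q' <= 4^-1 * (
      Q%:R * #|light3 q :&: light3 q'|%:R
      + Q%:R ^+ 2 * ((sparse om q)%:R * (w12 q q')%:R)
      + Q%:R ^+ 3 * (opposite q q')%:R).
    move=> q'L; rewrite /f /sparse_coef.
    have hs : {subset light3 q :&: light3 q' <= first3 q}.
      by move=> e; rewrite in_setI !in_set => /andP[/andP[]].
    have hs' : {subset light3 q :&: light3 q' <= first3 q'}.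
      by move=> e; rewrite in_setI !in_set => /andP[_ /andP[]].
    have hE := expn_card_shared Q_gt0 (lastq_closed qL) hs hs'.
    rewrite -/(w12 q q') in hE; move: (w12 q q') hE => w1 hE.
    rewrite -(ler_nat R) !natrD !natrM !natrX in hE.
    have Q0 : 0 <= Q%:R :> R by [].
    move: hE; set E := Q%:R ^+ #|_|; set n := #|_|%:R; set w := w1%:R.
    set o := (opposite q q')%:R => hE.
    have n0 : 0 <= Q%:R * n by rewrite mulr_ge0.
    have o0 : 0 <= Q%:R ^+ 3 * o by rewrite mulr_ge0 // exprn_ge0.
    have w0 : 0 <= Q%:R ^+ 2 * w by rewrite mulr_ge0 // exprn_ge0.
    have E1 : 1 <= E by apply: Q1.
    case: (sparse om q) => /=; last by rewrite !mul0r; lra.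
    by case: (sparse om q') => /=; lra.
  rewrite mulr_sumr; apply: (@le_trans _ _ (\sum_(q' in lastq | later q q')
      2^-1 * (Q%:R * #|light3 q :&: light3 q'|%:R
      + Q%:R ^+ 2 * ((sparse om q)%:R * (w12 q q')%:R)
      + Q%:R ^+ 3 * (opposite q q')%:R))).
    by apply: ler_sum => q' /andP[q'L _]; have := h q' q'L; lra.
  rewrite -mulr_sumr ler_pM2l ?invr_gt0 // !big_split /= -!mulr_sumr.
  apply: lerD; first apply: lerD => //.
    rewrite ler_wpM2l // big_mkcondr /=; apply: ler_sum => q' _.
    by case: ifP.
  rewrite ler_wpM2l ?exprn_ge0 // -natr_sum ler_nat.
  (* The outer two of the first three edges of [q] are shared with at most 8 listed cycles. *)
  case: q qL {h} => [[[x y] z] w] qL.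
  have n : [&& y != z, y != w, y != x, z != w, z != x & w != x].
    have := closed4_neq (lastq_closed qL).
    rewrite (eq_sym y x) (eq_sym z x) (eq_sym w x).
    by case/and5P => -> -> -> -> /andP[-> ->].
  apply: leq_trans (card_opposite_lastq G s n).
  rewrite -sum1_card [leqLHS]big_mkcond [leqRHS]big_mkcond /=.
  apply: leq_sum => q' _; rewrite [q' \in [set _ in _ | _]]in_set.
  by case: (q' \in lastq) => //=; case: (later _ _) => //; case: (_ && _).
apply: le_trans (mean_le step1) _; rewrite meanZ mean_sum.
have step2 q : q \in lastq -> mean (bound^~ q)
    <= Q%:R * \sum_(q' in lastq) #|light3 q :&: light3 q'|%:R
       + Q%:R ^+ 2 * (32 * Q'%:R) + Q%:R ^+ 3 * 8.
  move=> qL; rewrite /bound !meanD !mean_const // !meanZ lerD2r lerD2l.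
  rewrite ler_wpM2l ?exprn_ge0 //.
  case: q qL => [[[x y] z] w] qL; set W := \sum_(q' in lastq | _) _.
  have /and5P[xy xz xw yz /andP[yw zw]] := closed4_neq (lastq_closed qL).
  set t := index [set x; y] s.
  have hW : W <= (4 * #|common_nbrs_at s t y w|)%:R
               + (4 * #|common_nbrs_at s t x z|)%:R.
    rewrite /W -natr_sum -natrD ler_nat /w12 big_split /= (common_nbrs_atC _ _ x).
    apply: leq_add.
      have wz : w != z by rewrite eq_sym.
      apply: leq_trans (card_wedge_lastq s_edges t yw yz wz).
      rewrite -sum1_card [leqLHS]big_mkcond [leqRHS]big_mkcond /=.
      apply: leq_sum => q' _; rewrite [q' \in [set _ in _ | _]]in_set.
      case: (_ \in lastq) => //=; rewrite /later /= -/t.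
      by case: (_ <= t)%N => //=; case: (_ && _).
    have zx : z != x by rewrite eq_sym.
    apply: leq_trans (card_wedge_lastq s_edges t zx zw xw).
    rewrite -sum1_card [leqLHS]big_mkcond [leqRHS]big_mkcond /=.
    apply: leq_sum => q' _; rewrite [q' \in [set _ in _ | _]]in_set.
    case: (_ \in lastq) => //=; rewrite /later /= -/t.
      by case: (_ <= t)%N => //=; case: (_ && _).
  have p1 := prob_not_dense t y w; have p2 := prob_not_dense t x z.
  (* [W] does not depend on [om]. Its two parts come from wedges with ends y, w and with ends x, z;
     for each part, sparsity is bounded by the non-density of the matching diagonal. *)
  rewrite (eq_mean (g := fun om => W * (sparse om (x, y, z, w))%:R)); last first.
    by move=> om; rewrite mulrC.
  rewrite meanZ; set P := mean _.
  have P0 : 0 <= P by apply: mean_ge0.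
  have P1 : P <= mean (fun om => (~~ dense om t y w)%:R).
    apply: mean_le => om; rewrite /sparse /=.
    by case: (dense om _ x z); case: (dense om _ y w).
  have P2 : P <= mean (fun om => (~~ dense om t x z)%:R).
    apply: mean_le => om; rewrite /sparse /=.
    by case: (dense om _ x z); case: (dense om _ y w).
  apply: le_trans (ler_wpM2r P0 hW) _; rewrite mulrDl.
  have -> : 32 * Q'%:R = 16 * Q'%:R + 16 * Q'%:R :> R by ring.
  by apply: lerD; [apply: le_trans p1 | apply: le_trans p2];
     rewrite mulrC ler_wpM2r.
rewrite -ler_pdivlMl ?invr_gt0 // invrK.
apply: le_trans (ler_sum _ step2) _.
rewrite !big_split /= -mulr_sumr !sumr_const.
rewrite -[X in _ + X + _]mulr_natl -[X in _ + _ + X]mulr_natl.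
rewrite (card_lastq s_edges) natrM.
have := ler_wpM2l (ler0n R Q) sum_light3_shared.
set S := _ * \sum_(q in lastq) _ => hS.
have -> : 2 * (6 * Q%:R * T%:R ^+ 2 / Q'%:R + 32 * Q%:R ^+ 2 * Q'%:R * T%:R
     + 8 * Q%:R ^+ 3 * T%:R) = Q%:R * (12 * T%:R ^+ 2 / Q'%:R)
   + 2 * T%:R * (Q%:R ^+ 2 * (32 * Q'%:R)) + 2 * T%:R * (Q%:R ^+ 3 * 8) :> R.
  by ring.
by rewrite !lerD2r.
Qed.

(** Two hits imply at least one, and common neighbours only accumulate. This linear bound serves
    cycles sharing one center, the quadratic one below those sharing both. *)
Lemma prob_dense_diag (q : quad V) :
  mean (fun om => (dense_diag om q)%:R) <= (codeg G q)%:R / Q'%:R :> R.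
Proof.
case: q => [[[x y] z] w] /=.
have cn := common_nbrs_at_sub s_edges (index [set x; y] s) x z.
apply: le_trans (_ : _ <= #|common_nbrs_at s (index [set x; y] s) x z|%:R / Q'%:R) _.
  apply: le_trans (prob_hits_ge1 smpWP isT (subsetT _)).
  by apply: mean_le => om; rewrite ler_nat /dense; case: (hits _ _ _) => [|[]].
by rewrite ler_wpM2r ?invr_ge0 // ler_nat subset_leq_card.
Qed.

Lemma prob_dense_diag2 (q : quad V) :
  mean (fun om => (dense_diag om q)%:R) <= (codeg G q ^ 2)%:R / Q'%:R ^+ 2 :> R.
Proof.
case: q => [[[x y] z] w] /=.
have cn := common_nbrs_at_sub s_edges (index [set x; y] s) x z.
apply: le_trans (prob_hits_ge2 smpWP isT (subsetT _)) _.
rewrite natrX expr_div_n ler_wpM2r ?invr_ge0 ?exprn_ge0 //.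
by rewrite lerXn2r ?nnegrE // ler_nat subset_leq_card.
Qed.

Lemma card_centers (q : quad V) : (#|centers q| <= 2)%N.
Proof. by case: q => [[[x y] z] w]; rewrite /= cards2; case: (_ != _). Qed.

(** Sharing one center costs Q, sharing both Q^2. The density of [q] is dropped and that of [q']
    retained: with d the codegree of [q'], the sum of d/Q' over cycles through one center is
    O(T/Q'), and that of (d/Q')^2 over cycles with given centers is O(T/Q'^2). *)
Lemma dense_variance :
  mean (fun om => mean (fun ov =>
    (dense_est ov om - \sum_(q in lastq) dense_coef om q) ^+ 2))
  <= 64 * Q%:R * T%:R ^+ 2 / Q'%:R + 64 * Q%:R ^+ 2 * T%:R ^+ 2 / Q'%:R ^+ 2.
Proof.
pose sh (q q' : quad V) : R := Q%:R * \sum_(v in centers q) (v \in centers q')%:R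
  + Q%:R ^+ 2 * (centers q' == centers q)%:R.
have step1 om : mean (fun ov =>
    (dense_est ov om - \sum_(q in lastq) dense_coef om q) ^+ 2)
    <= \sum_(q in lastq) \sum_(q' in lastq) sh q q' * (dense_diag om q')%:R.
  rewrite (sampled_sum_variance smpVP) //; last first.
    by move=> q _; have := card_centers q; rewrite -leq_double => /leq_trans; apply.
  apply: ler_sum => q _; apply: ler_sum => q' _.
  have c0 p : 0 <= dense_coef om p by apply: mulr_ge0 => //; case: ifP => _; lra.
  have c1 p : dense_coef om p <= (dense_diag om p)%:R.
    by rewrite ler_piMr //; case: ifP => _ //; lra.
  have d1 p : (dense_diag om p)%:R <= 1 :> R by case: (dense_diag _ _).
  have hs : Q%:R ^+ #|centers q :&: centers q'| - 1 <= sh q q'.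
    have -> : sh q q' = Q%:R * #|centers q :&: centers q'|%:R
        + Q%:R ^+ 2 * (centers q' == centers q)%:R.
      rewrite /sh; congr (_ * _ + _).
      rewrite -sum1_card natr_sum big_mkcond [RHS]big_mkcond /=.
      by apply: eq_bigr => v _; rewrite in_setI; do 2 case: (_ \in _).
    suff : (Q ^ #|centers q :&: centers q'| <= 1 + (Q * #|centers q :&: centers q'|
        + Q ^ 2 * (centers q' == centers q)))%N.
      by rewrite -(ler_nat R) !natrD !natrM !natrX lerBlDl.
    have k2 := leq_trans (subset_leq_card (subsetIl (centers q) (centers q'))) (card_centers q).
    case k : #|centers q :&: centers q'| k2 => [|[|[|//]]] _.
    - by rewrite expn0.
    - by rewrite expn1 muln1; clear; lia.
    have e1 : centers q :&: centers q' = centers q.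
      by apply/eqP; rewrite eqEcard subsetIl k card_centers.
    have e2 : centers q :&: centers q' = centers q'.
      by apply/eqP; rewrite eqEcard subsetIr k card_centers.
    by rewrite (etrans (esym e1) e2) eqxx muln1; clear; lia.
  have s0 : 0 <= Q%:R ^+ #|centers q :&: centers q'| - 1 :> R.
    by rewrite subr_ge0 -natrX ler1n expn_gt0 Q_gt0.
  rewrite [leRHS]mulrC; apply: ler_pM => //; first exact: mulr_ge0.
  rewrite -[leRHS]mul1r; apply: ler_pM => //.
  exact: le_trans (c1 q) (d1 q).
apply: le_trans (mean_le step1) _; rewrite mean_sum.
have step2 q : q \in lastq ->
    mean (fun om => \sum_(q' in lastq) sh q q' * (dense_diag om q')%:R)
    <= Q%:R * (2 * (16 * T%:R / Q'%:R)) + Q%:R ^+ 2 * (32 * T%:R / Q'%:R ^+ 2).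
  move=> qL; rewrite mean_sum; under eq_bigr do rewrite meanZ mulrDl -!mulrA.
  rewrite big_split /= -!mulr_sumr; apply: lerD.
    rewrite ler_wpM2l //; under eq_bigr do rewrite mulr_suml.
    rewrite exchange_big /=.
    apply: (@le_trans _ _ (\sum_(v in centers q) 16 * T%:R / Q'%:R)).
      apply: ler_sum => v _.
      apply: (@le_trans _ _ (\sum_(q' in lastq | v \in centers q') (codeg G q')%:R / Q'%:R)).
        rewrite [leRHS]big_mkcondr; apply: ler_sum => q' _.
        by case: (_ \in _); rewrite ?mul0r // mul1r prob_dense_diag.
      rewrite -mulr_suml ler_wpM2r ?invr_ge0 // -natr_sum -natrM ler_nat.
      exact: sum_codeg_center.
    rewrite sumr_const -[leLHS]mulr_natl ler_wpM2r ?ler_nat ?card_centers //.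
    by rewrite !mulr_ge0 ?invr_ge0.
  rewrite mulrA -expr2 ler_wpM2l ?exprn_ge0 //.
  apply: (@le_trans _ _ (\sum_(q' in lastq | centers q' == centers q)
      (codeg G q' ^ 2)%:R / Q'%:R ^+ 2)).
    rewrite [leRHS]big_mkcondr; apply: ler_sum => q' _.
    by case: (_ == _); rewrite ?mul0r // mul1r prob_dense_diag2.
  rewrite -mulr_suml ler_wpM2r ?invr_ge0 ?exprn_ge0 // -natr_sum -natrM ler_nat.
  case: q qL => [[[x y] z] w] /lastq_closed/closed4_neq/and5P[_ _ _ _ /andP[yw _]].
  exact: sum_codeg_centers.
apply: le_trans (ler_sum _ step2) _.
rewrite sumr_const -[leLHS]mulr_natl (card_lastq s_edges) natrM.
by rewrite le_eqVlt; apply/orP; left; apply/eqP; ring.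
Qed.

(** At rate 1 every factor Q^k - 1 of the variance vanishes. This covers the parameters too small
    for a nontrivial rate. *)
Lemma variance_unsampled (om : Ow) : Q = 1%N ->
  mean (fun oe =>
    (sparse_est oe om - \sum_(q in lastq) sparse_coef om q) ^+ 2) = 0
  /\ mean (fun ov =>
    (dense_est ov om - \sum_(q in lastq) dense_coef om q) ^+ 2) = 0.
Proof.
move=> Q1; split.
  rewrite (sampled_sum_variance smpEP) //; first last.
  - by move=> q _; have := card_light3 q; rewrite -leq_double.
  - exact: light3_sub.
  by rewrite big1 // => q _; rewrite big1 // => q' _;
     rewrite Q1 expr1n subrr mulr0.
rewrite (sampled_sum_variance smpVP) //; last first.
  by move=> q _; have := card_centers q; rewrite -leq_double => /leq_trans; apply.
by rewrite big1 // => q _; rewrite big1 // => q' _;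
   rewrite Q1 expr1n subrr mulr0.
Qed.

End Variance.


(** * Updating the counter from the stored edges *)

Section Increment.
Variables (V : finType) (Q : nat).
Variables (inA : {set V} -> bool) (inS inW : V -> bool).

(** Edges at vertices of [inW] are stored for the density test alone. *)
Definition keep (e : {set V}) (b : bool) : bool :=
  [|| b, inA e | [exists u in e, inS u || inW u]].

Definition seen (K : seq ({set V} * bool)) (e : {set V}) : bool :=
  e \in unzip1 K.

Definition flagged (K : seq ({set V} * bool)) (e : {set V}) : bool :=
  (e, true) \in K.

Definition dense_seen (K : seq ({set V} * bool)) (e : {set V}) (x z : V) : bool :=
  (1 < #|[set u | [&& inW u, [set x; u] \in e :: unzip1 K
                     & [set u; z] \in e :: unzip1 K]]|)%N.

(** Twice the inverse-probability share of the cycle, so that the counter stays a natural number. A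
    diagonal that alone is dense carries the whole cycle, two dense ones half each, whence the
    factors 2 and 1. *)
Definition contribution (dn dc : bool) (fl : {set V} -> bool) (q : quad V) : nat :=
  let: (x, y, z, w) := q in
  ([&& ~~ dn, ~~ dc & all (fun f => fl f || inA f) (first3 q)]
     * Q ^ count (fun f => ~~ fl f) (first3 q)
   + [&& dn, inS y & inS w] * (if dc then 1 else 2) * Q ^ 2)%N.

Definition increment (K : seq ({set V} * bool)) (e : {set V}) : nat :=
  (\sum_(q : quad V | let: (x, y, z, w) := q in
       [&& uniq [:: x; y; z; w], e == [set x; y] & all (seen K) (first3 q)])
     let: (x, y, z, w) := q in
     contribution (dense_seen K e x z) (dense_seen K e y w) (flagged K) q)%N.

Variables (G : sgraph V) (s : seq {set V}).
Hypothesis s_edges : s =i edges G.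
Variable heavy : {set V} -> bool.

Definition dense_at (t : nat) (x z : V) : bool :=
  (1 < #|[set u in common_nbrs_at s t x z | inW u]|)%N.

Definition score (q : quad V) : nat :=
  let: (x, y, z, w) := q in
  contribution (dense_at (qtime s q) x z) (dense_at (qtime s q) y w) heavy q.

Definition last_edge (q : quad V) : {set V} :=
  let: (x, y, z, w) := q in [set x; y].

(** The stored edges suffice. Density is seen correctly because all edges at vertices of [inW] are
    stored. A sparse cycle counts only if its earlier edges are heavy or sampled, a dense one only
    if both centers are sampled, and in either case those edges are stored. *)
Lemma incrementE (K : seq ({set V} * bool)) (e : {set V}) :
  e \in s ->
  (forall f b, ((f, b) \in K) =
     [&& f \in take (index e s) s, b == heavy f & keep f b]) ->
  increment K e = (\sum_(q in lastq G s | last_edge q == e) score q)%N.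
Proof.
move=> es KP; set t := index e s.
have seenE f : seen K f = (f \in take t s) && keep f (heavy f).
  apply/mapP/andP => [[[f' b]] /= | [ft kf]].
    by rewrite KP => /and3P[h1 /eqP bh h2] ->; rewrite h1 -bh.
  by exists (f, heavy f); rewrite // KP ft eqxx kf.
have flagE f : f \in take t s -> flagged K f = heavy f.
  move=> ft; rewrite /flagged KP -/t ft /=.
  by rewrite /keep /= andbT; case: (heavy f).
have take1 f : (f \in take t.+1 s) = (f == e) || (f \in take t s).
  have [fs | fs] := boolP (f \in s); last first.
    rewrite (contraNF (@mem_take _ _ _ _) fs) (contraNF (@mem_take _ _ _ _) fs).
    by rewrite orbF; apply/esym/negP => /eqP fe; rewrite fe es in fs.
  rewrite !in_take // ltnS leq_eqVlt; congr (_ || _); apply/eqP/eqP => [|->] //.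
  exact: index_inj.
have denseE x z : dense_seen K e x z = dense_at t x z.
  rewrite /dense_seen /dense_at; congr (_ < _)%N; apply: eq_card => u.
  rewrite !in_set; have [Wu | Wu] := boolP (inW u); last by rewrite andbF.
  rewrite andbT /= !in_cons -!/(seen K _) !seenE !take1.
  have k (f : {set V}) : u \in f -> keep f (heavy f).
    by move=> uf; apply/or3P/Or33/exists_inP; exists u; rewrite // Wu orbT.
  by rewrite !k ?andbT // !inE eqxx ?orbT.
rewrite /increment big_mkcond [RHS]big_mkcond; apply: eq_bigr => -[[[x y] z] w] _.
set u4 := uniq [:: x; y; z; w].
rewrite [_ && (last_edge _ == e)]andbC /= [[set x; y] == e]eq_sym.
have [exy | _] := eqVneq e [set x; y]; last by rewrite andbF.
have inL : (x, y, z, w) \in lastq G s =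
    u4 && all (mem (take t s)) (first3 (x, y, z, w)).
  rewrite in_set /closed4 -/u4; case: u4 => //=; rewrite -!(mem_stream s_edges) -exy es /= -/t.
  rewrite !andbT; have tk f : (f \in take t s) = (f \in s) && (index f s < t)%N.
    have [fs|fs] := boolP (f \in s); first by rewrite in_take.
    by rewrite (contraNF (@mem_take _ _ _ _) fs).
  by rewrite !tk; do 3 case: (_ \in s); rewrite /= ?andbF.
rewrite inL -exy -/t !denseE /=.
case: u4 {inL} => //=; rewrite -!/(seen K _) !seenE !andbT.
have [/and3P[t1 t2 t3] | nt] := boolP [&& [set y; z] \in take t s,
    [set z; w] \in take t s & [set w; x] \in take t s]; last first.
  by rewrite ifN //; apply: contraNN nt => /and3P[/andP[-> _] /andP[-> _] /andP[-> _]].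
rewrite t1 t2 t3 !flagE //=.
have [//|nk] := boolP [&& _, _ & _].
have kS u (f : {set V}) : u \in f -> inS u -> keep f (heavy f).
  by move=> uf Su; apply/or3P/Or33/exists_inP; exists u; rewrite // Su.
(* Each of yz, zw, wx has y or w as an end, so sampling both would store all three. *)
have -> : inS y && inS w = false.
  apply/negP => /andP[Sy Sw]; case/negP: nk.
  by rewrite (kS y) ?(kS w) // !inE eqxx ?orbT.
have kE f : heavy f || inA f -> keep f (heavy f).
  by rewrite /keep orbA => ->.
have nA : [&& heavy [set y; z] || inA [set y; z], heavy [set z; w] || inA [set z; w]
    & heavy [set w; x] || inA [set w; x]] = false.
  by apply/negP; apply/negP; apply: contraNN nk => /and3P[/kE-> /kE-> /kE->].
by rewrite ?andbT nA !andbF.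
Qed.

(** Crude, but enough to bound the number of bits of the counter. *)
Lemma score_le (q : quad V) : (0 < Q)%N -> (score q <= 3 * Q ^ 3)%N.
Proof.
move=> Q0; case: q => [[[x y] z] w]; rewrite /score /contribution.
have c3 : (count (fun f => ~~ heavy f) (first3 (x, y, z, w)) <= 3)%N.
  exact: count_size.
have h1 : (Q ^ count (fun f => ~~ heavy f) (first3 (x, y, z, w)) <= Q ^ 3)%N.
  by rewrite leq_pexp2l.
have h2 : (Q ^ 2 <= Q ^ 3)%N by rewrite leq_pexp2l.
move: h1 h2; set A := (Q ^ count _ _)%N; set B := (Q ^ 3)%N; set C := (Q ^ 2)%N.
by case: (dense_at _ x z); case: (dense_at _ y w); case: (all _ _);
   case: (_ && _) => /=; lia.
Qed.

Lemma sum_increments (t : nat) (K : nat -> seq ({set V} * bool)) (e0 : {set V}) :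
  uniq s -> (t <= size s)%N ->
  (forall i f b, (i < size s)%N -> ((f, b) \in K i) =
     [&& f \in take i s, b == heavy f & keep f b]) ->
  (\sum_(i < t) increment (K i) (nth e0 s i)
   = \sum_(q in lastq G s | last_edge q \in take t s) score q)%N.
Proof.
move=> us ts KP.
rewrite [RHS](partition_big last_edge (mem (take t s))) /=; last by move=> q /andP[].
transitivity (\sum_(e <- take t s)
    \sum_(q in lastq G s | last_edge q == e) score q)%N; last first.
  rewrite big_uniq ?take_uniq //=; apply: eq_bigr => e et; apply: eq_bigl => q.
  by rewrite -andbA; case: (q \in _) => //=; case: eqP => [->|]; rewrite ?et ?andbF.
rewrite (big_nth e0) size_takel // big_mkord; apply: eq_bigr => i _.
have it : (i < size s)%N by apply: leq_trans ts.
rewrite nth_take // (@incrementE (K i) (nth e0 s i)) ?mem_nth // => f b.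
by rewrite KP // index_uniq.
Qed.

End Increment.


(** * Storage *)

Section Storage.
Variable R : realType.

Definition harmonic_sum (j : nat) : R := \sum_(i < j) i.+1%:R^-1.

Definition decay (j : nat) : R := (j%:R * harmonic_sum j ^+ 2)^-1.

Lemma harmonic_sumS (j : nat) : harmonic_sum j.+1 = harmonic_sum j + j.+1%:R^-1.
Proof. by rewrite /harmonic_sum big_ord_recr. Qed.

Lemma harmonic_sum_le (i j : nat) : (i <= j)%N -> harmonic_sum i <= harmonic_sum j.
Proof.
move=> /subnKC <-; elim: (j - i)%N => [|k IH]; first by rewrite addn0.
by rewrite addnS harmonic_sumS (le_trans IH) // lerDl invr_ge0.
Qed.

Lemma harmonic_sum_ge1 (j : nat) : 1 <= harmonic_sum j.+1.
Proof.
apply: le_trans (@harmonic_sum_le 1 j.+1 _) => //.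
by rewrite /harmonic_sum big_ord1 invr1.
Qed.

(** Induction, with ln(1 - 1/k) <= -1/k at k = [j.+2]. *)
Lemma harmonic_sum_ln (j : nat) : harmonic_sum j.+1 <= 1 + ln j.+1%:R.
Proof.
elim: j => [|j IH]; first by rewrite /harmonic_sum big_ord1 invr1 ln1 addr0.
rewrite harmonic_sumS; apply: le_trans (lerD IH (lexx _)) _.
rewrite -addrA lerD2l.
have h0 : 0 < j.+1%:R / j.+2%:R :> R by rewrite divr_gt0.
have -> : ln (j.+1%:R : R) = ln j.+2%:R + ln (j.+1%:R / j.+2%:R).
  by rewrite -lnM ?posrE // mulrCA divff ?mulr1 // pnatr_eq0.
rewrite -addrA gerDl.
have -> : j.+1%:R / j.+2%:R = 1 + - j.+2%:R^-1 :> R.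
  have n0 : j.+2%:R != 0 :> R by rewrite pnatr_eq0.
  by apply: (mulIf n0); rewrite mulfVK // mulrDl mul1r mulNr mulVf // -[j.+2%:R]natr1 addrK.
have : - j.+2%:R^-1 > -1 :> R by rewrite ltrN2 invf_lt1 // ltr1n.
by move=> /le_ln1Dx h; rewrite -lerBrDr sub0r.
Qed.

Lemma decay_gt0 (j : nat) : 0 < decay j.+1.
Proof.
rewrite invr_gt0 mulr_gt0 // exprn_gt0 // (lt_le_trans ltr01) //.
exact: harmonic_sum_ge1.
Qed.

Lemma decay_le (i j : nat) : (i <= j)%N -> decay j.+1 <= decay i.+1.
Proof.
move=> ij; have hi := harmonic_sum_ge1 i; have hj := harmonic_sum_ge1 j.
have hij := @harmonic_sum_le i.+1 j.+1 ij.
have hi0 := lt_le_trans ltr01 hi; have hj0 := lt_le_trans ltr01 hj.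
rewrite lef_pV2 ?posrE ?mulr_gt0 ?exprn_gt0 //.
apply: ler_pM; rewrite ?exprn_ge0 ?ler_nat ?(ltW hi0) //.
by rewrite lerXn2r ?nnegrE // ltW.
Qed.

(* Telescoping: [decay k.+1 <= (harmonic_sum k)^-1 - (harmonic_sum k.+1)^-1]. *)
Lemma sum_decay (m : nat) : \sum_(i < m) decay i.+1 <= 2.
Proof.
case: m => [|m]; first by rewrite big_ord0.
suff : \sum_(i < m.+1) decay i.+1 <= 2 - (harmonic_sum m.+1)^-1.
  move/le_trans; apply; rewrite gerBl invr_ge0 (le_trans ler01) //.
  exact: harmonic_sum_ge1.
elim: m => [|m IH].
  rewrite big_ord1 /decay /harmonic_sum big_ord1 invr1 expr1n mulr1 invr1; lra.
rewrite big_ord_recr /=; apply: le_trans (lerD IH (lexx _)) _.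
have h1 := harmonic_sum_ge1 m; have h2 := harmonic_sum_ge1 m.+1.
have e := harmonic_sumS m.+1; rewrite /decay.
set a := harmonic_sum m.+1 in h1 e *; set b := harmonic_sum m.+2 in h2 e *.
set k : R := m.+2%:R in e *; have k0 : 0 < k by rewrite ltr0n.
have a0 : 0 < a by apply: lt_le_trans h1.
have b0 : 0 < b by apply: lt_le_trans h2.
have ab : a <= b by rewrite e lerDl invr_ge0 ltW.
clearbody a b k.
suff h : (k * b ^+ 2)^-1 <= a^-1 - b^-1.
  by rewrite -addrA lerD2l addrC lerBlDr addrC.
have -> : a^-1 - b^-1 = (k * (a * b))^-1.
  have -> : a = b - k^-1 by rewrite e addrK.
  have : b - k^-1 != 0 by rewrite e addrK gt_eqF.
  move=> n0; have k1 := lt0r_neq0 k0; have b1 := lt0r_neq0 b0.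
  have n1 : b * k - 1 != 0.
    by apply: contraNN n0 => /eqP n1; rewrite -(mulfK k1 b) (_ : b * k = 1) ?mul1r ?subrr; lra.
  by field; rewrite k1 b1 n1.
rewrite lef_pV2 ?posrE ?mulr_gt0 ?exprn_gt0 // ler_pM2l //.
by rewrite expr2 ler_pM2r.
Qed.

End Storage.


(** * Success probability *)

Lemma between_add (R : realFieldType) (a t u v : R) :
  - a < u < a -> - a < v < a -> t - (a + a) <= t + u + v <= t + (a + a).
Proof. by move=> /andP[? ?] /andP[? ?]; apply/andP; split; lra. Qed.

(** Three exceptional events of probability at most 1/20 each leave 17/20, above 7/10. *)
Lemma most_outside (R : realFieldType) (N g b1 b2 b3 : R) :
  b1 <= 20^-1 * N -> b2 <= 20^-1 * N -> b3 <= 20^-1 * N ->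
  0 < N -> N <= g + (b1 + (b2 + b3)) -> 7 / 10 * N <= g.
Proof. lra. Qed.

Section Success.
Variables (R : realType) (V : finType) (G : sgraph V) (s : seq {set V}).
Hypothesis s_uniq : uniq s.
Hypothesis s_edges : s =i edges G.
Variable heavy : {set V} -> bool.
Variables (Q Q' : nat).
Hypothesis Q_gt0 : (0 < Q)%N.
Hypothesis Q_le : (Q <= Q')%N.
Hypothesis heavyP : perfect_oracle G (Q'%:R : R) heavy.
Variables (Oe Ov Ow : finType).
Variables (smpE : Oe -> {set V} -> bool) (smpV : Ov -> V -> bool).
Variable smpW : Ow -> V -> bool.
Hypothesis smpEP : sampler R (edges G) 6 Q smpE.
Hypothesis smpVP : sampler R [set: V] 6 Q smpV.
Hypothesis smpWP : sampler R [set: V] 6 Q' smpW.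
Hypothesis Oe_gt0 : (0 < #|Oe|)%N.
Hypothesis Ov_gt0 : (0 < #|Ov|)%N.
Hypothesis Ow_gt0 : (0 < #|Ow|)%N.

Local Notation T := (num_C4 G).
Local Notation Om := (Oe * Ov * Ow)%type.

Let Q'_gt0 : (0 < Q')%N. Proof. exact: leq_trans Q_le. Qed.

Definition estimate (sd : Om) : R :=
  (\sum_(q in lastq G s)
     score Q (smpE sd.1.1) (smpV sd.1.2) (smpW sd.2) s heavy q)%:R / 2.

(** Halving undoes the doubling in [contribution]; the identity is checked cycle by cycle over the
    density and sampling bits. *)
Lemma estimateE (sd : Om) :
  estimate sd = sparse_est R G s heavy Q smpE smpW sd.1.1 sd.2
              + dense_est R G s Q smpV smpW sd.1.2 sd.2.
Proof.
rewrite /estimate natr_sum mulr_suml -big_split /=; apply: eq_bigr => q qL.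
have uq := first3_uniq (lastq_closed qL).
have cl : #|light3 heavy q| = count (fun f => ~~ heavy f) (first3 q).
  rewrite -size_filter -(card_uniqP (filter_uniq _ uq)).
  by apply: eq_card => e; rewrite in_set mem_filter andbC.
have pl : \prod_(e in light3 heavy q) (smpE sd.1.1 e)%:R
    = (all (fun f => heavy f || smpE sd.1.1 f) (first3 q))%:R :> R.
  case: allP => [h | nh].
    rewrite big1 // => e; rewrite in_set => /andP[/h + /negbTE nhe].
    by rewrite nhe /= => ->.
  apply/eqP; rewrite prodf_seq_eq0; apply/hasP.
  have /allPn[e e3] : ~~ all (fun f => heavy f || smpE sd.1.1 f) (first3 q).
    by apply/negP => /allP.
  rewrite negb_or => /andP[h1 /negbTE h2]; exists e; rewrite ?mem_index_enum //.
  by rewrite in_set e3 h1 h2 /=.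
rewrite /inv_weight cl pl; case: q qL {uq cl pl} => [[[x y] z] w] qL.
have /and5P[_ _ _ _ /andP[yw _]] := closed4_neq (lastq_closed qL).
rewrite /sparse_coef /dense_coef /sparse [centers _]/= cards2 yw.
rewrite big_setU1 ?inE // big_set1 /score /contribution natrD !natrM !natrX.
set d1 := dense_at _ _ _ x z; set d2 := dense_at _ _ _ y w.
rewrite -[dense_diag _ _ _ _]/d1 -[dense_codiag _ _ _ _]/d2.
set E := Q%:R ^+ count _ _; set al := all _ _.
by case: d1; case: d2; case: al; case: (smpV _ y); case: (smpV _ w) => /=; field.
Qed.

Lemma mean_EW (g : Oe -> Ow -> R) :
  mean (fun sd : Om => g sd.1.1 sd.2) = mean (fun om => mean (g^~ om)).
Proof.
rewrite mean_pair (mean_pair (fun p : Oe * Ov => mean (g p.1))) /=.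
by rewrite [RHS]mean_swap; apply: eq_mean => oe; rewrite mean_const.
Qed.

Lemma mean_VW (g : Ov -> Ow -> R) :
  mean (fun sd : Om => g sd.1.2 sd.2) = mean (fun om => mean (g^~ om)).
Proof.
rewrite mean_pair (mean_pair (fun p : Oe * Ov => mean (g p.2))) /=.
by rewrite mean_const // [RHS]mean_swap.
Qed.

Definition kept_light (sd : Om) (j : nat) : nat :=
  count (fun f => ~~ heavy f &&
           keep (smpE sd.1.1) (smpV sd.1.2) (smpW sd.2) f (heavy f)) (take j s).

Definition capacity (j : nat) : R :=
  200 / Q%:R * (j%:R * harmonic_sum R j ^+ 2).

Definition within_capacity (sd : Om) : bool :=
  all (fun j => (kept_light sd j)%:R <= capacity j) (iota 1 (size s)).

(** Union bound over five events: the edge itself is sampled, or one of its two ends is in [smpV]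
    (rate 1/Q) or in [smpW] (rate 1/Q' <= 1/Q). *)
Lemma prob_kept_light (f : {set V}) :
  f \in s -> mean (fun sd : Om => (~~ heavy f &&
    keep (smpE sd.1.1) (smpV sd.1.2) (smpW sd.2) f (heavy f))%:R) <= 5 / Q%:R :> R.
Proof.
move=> fs; have Qi : (Q'%:R : R)^-1 <= Q%:R^-1.
  by rewrite lef_pV2 ?posrE ?ltr0n ?ler_nat.
have Q0 : (0 : R) <= Q%:R^-1 by rewrite invr_ge0.
have : f \in edges G by rewrite -s_edges.
case/imsetP => -[x y]; rewrite inE /= => xy ef.
apply: (@le_trans _ _ (mean (fun sd : Om => (smpE sd.1.1 f)%:R +
   ((smpV sd.1.2 x)%:R + (smpV sd.1.2 y)%:R)
   + ((smpW sd.2 x)%:R + (smpW sd.2 y)%:R)))).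
  apply: mean_le => sd; rewrite -!natrD ler_nat /keep.
  case: (heavy f) => //=; case: (smpE _ f) => //=.
  case: exists_inP => [[u]|_ //]; rewrite ef !inE.
  by case/orP => /eqP-> /orP[]->; rewrite ?addn1 ?add1n //=; lia.
rewrite !meanD (mean_EW (fun oe _ => (smpE oe f)%:R)).
rewrite (mean_VW (fun ov _ => (smpV ov x)%:R)) (mean_VW (fun ov _ => (smpV ov y)%:R)).
rewrite (mean_VW (fun _ om => (smpW om x)%:R)) (mean_VW (fun _ om => (smpW om y)%:R)).
rewrite !mean_const //.
rewrite (mean_sampler1 smpEP) // -?s_edges // !(mean_sampler1 smpVP) //.
have W u : mean (fun om => mean (fun _ : Ov => (smpW om u)%:R)) = Q'%:R^-1 :> R.
  rewrite -(mean_sampler1 smpWP (x := u)) //; apply: eq_mean => om.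
  by rewrite mean_const.
rewrite !W; lra.
Qed.

Lemma prob_overflow :
  #|[pred sd : Om | ~~ within_capacity sd]|%:R / #|(Om : finType)|%:R <= 20^-1 :> R.
Proof.
pose x (i : 'I_(size s)) (sd : Om) : R :=
  (let f := nth set0 s i in ~~ heavy f &&
    keep (smpE sd.1.1) (smpV sd.1.2) (smpW sd.2) f (heavy f))%:R.
pose Phi sd := \sum_(i < size s) decay R i.+1 * x i sd.
have Qp : 0 < Q%:R :> R by rewrite ltr0n.
have Phi0 sd : 0 <= Phi sd.
  by apply: sumr_ge0 => i _; rewrite mulr_ge0 // ltW // decay_gt0.
(* The weights sum to at most 2, and a light edge is kept with probability at most 5/Q. *)
have mPhi : mean Phi <= 10 / Q%:R.
  rewrite mean_sum; apply: (@le_trans _ _ (\sum_(i < size s) decay R i.+1 * (5 / Q%:R))).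
    apply: ler_sum => i _; rewrite meanZ ler_wpM2l // ?(ltW (decay_gt0 _ _)) //.
    exact/prob_kept_light/mem_nth.
  rewrite -mulr_suml; have := sum_decay R (size s); set d := \sum_(i < _) _ => d2.
  have q0 : 0 <= 5 / Q%:R :> R by rewrite divr_ge0.
  by apply: le_trans (ler_wpM2r q0 d2) _; lra.
have a0 : 0 < 200 / Q%:R :> R by rewrite divr_gt0.
(* On overflow at position j, each light edge kept among the first j has weight at least that of j,
   so [Phi] reaches 200/Q, twenty times the bound on its mean. *)
apply: (@le_trans _ _ (#|[pred sd | 200 / Q%:R <= Phi sd]|%:R / #|(Om : finType)|%:R)).
  rewrite ler_wpM2r ?invr_ge0 // ler_nat; apply/subset_leq_card/subsetP => sd.
  rewrite !inE => /allPn[j]; rewrite mem_iota add1n ltnS => /andP[j0 js].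
  case: j j0 js => // j _ js; rewrite -ltNge => lt_cap.
  apply: (@le_trans _ _ (decay R j.+1 * (kept_light sd j.+1)%:R)).
    move: lt_cap; rewrite /capacity -ltr_pdivlMr; last first.
      by have := decay_gt0 R j; rewrite invr_gt0.
    by move=> /ltW; rewrite [X in _ -> is_true (_ <= X)]mulrC.
  have -> : (kept_light sd j.+1)%:R = \sum_(i < size s | (i < j.+1)%N) x i sd.
    rewrite /kept_light -sum1_count natr_sum big_mkcond (big_nth set0) size_takel //.
    rewrite big_mkord (big_ord_widen_cond _ xpredT (fun i =>
      let f := nth set0 (take j.+1 s) i in
      if ~~ heavy f && keep (smpE sd.1.1) (smpV sd.1.2) (smpW sd.2) f (heavy f)
      then 1%N%:R else 0) js).
    apply: eq_bigr => i ij; rewrite nth_take // /x /=.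
    by case: (_ && _).
  rewrite mulr_sumr [leRHS](bigID (fun i : 'I__ => (i < j.+1)%N)) /=.
  rewrite -[leLHS]addr0; apply: lerD.
    apply: ler_sum => i ij; rewrite ler_wpM2r // decay_le //.
  by apply: sumr_ge0 => i _; rewrite mulr_ge0 // ltW // decay_gt0.
apply: le_trans (markov_mean a0 Phi0) _.
rewrite ler_pdivrMr //; apply: le_trans mPhi _.
by rewrite le_eqVlt; apply/orP; left; apply/eqP; field; rewrite gt_eqF.
Qed.

Variables (eps C : R).
Hypothesis eps01 : 0 < eps < 1.
Hypothesis T_gt0 : (0 < T)%N.
Hypothesis C_ge1 : 1 <= C.
Hypothesis Q'_cube : Q'%:R ^+ 3 <= C * T%:R.
Hypothesis Q_eps : Q = 1%N \/ 10000 * C * Q%:R <= eps ^+ 2 * Q'%:R.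

(** In terms of r = Q/Q' both variance bounds turn into multiples of r T^2, the sparse one with the
    help of Q'^3 <= C T. *)
Lemma sampling_ratio : 10000 * C * Q%:R <= eps ^+ 2 * Q'%:R ->
  exists r : R, [/\ 0 <= r, Q%:R = r * Q'%:R, 10000 * (C * r) <= eps ^+ 2,
                   0 < eps & eps ^+ 2 <= 1].
Proof.
move=> Qs; have b0 : 0 < Q'%:R :> R by rewrite ltr0n.
have /andP[e0 e1] := eps01; exists (Q%:R / Q'%:R); split=> //.
- by rewrite divr_ge0.
- by rewrite divfK // gt_eqF.
- by rewrite mulrA mulrA ler_pdivrMr.
- by rewrite expr_le1 // ltW.
Qed.

(** Unless Q = 1, the variance is at most 8 r T^2 with r = Q/Q' <= eps^2/10^4, and 8/10^4 is below
    the 1/80 allowed. *)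
Lemma sparse_error :
  mean (fun sd : Om => (sparse_est R G s heavy Q smpE smpW sd.1.1 sd.2
     - \sum_(q in lastq G s) sparse_coef R s smpW sd.2 q) ^+ 2)
  <= (eps * T%:R / 2) ^+ 2 / 20.
Proof.
rewrite (mean_EW (fun oe om => (sparse_est R G s heavy Q smpE smpW oe om
     - \sum_(q in lastq G s) sparse_coef R s smpW om q) ^+ 2)).
have r0 : 0 <= (eps * T%:R / 2) ^+ 2 / 20 by rewrite divr_ge0 ?sqr_ge0.
case: Q_eps => [Q1 | Qs].
  apply: le_trans r0; rewrite (eq_mean (g := fun=> 0)) ?mean_const // => om.
  by have [-> _] := variance_unsampled s heavy Q_gt0 smpW smpEP smpVP Oe_gt0 Ov_gt0 om Q1.
apply: le_trans (sparse_variance s_edges Q_gt0 Q'_gt0 heavyP smpEP smpWP Oe_gt0 Ow_gt0) _.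
have [r [r0' ar Cr e0 e1]] := sampling_ratio Qs.
have rC : r <= C * r by rewrite ler_peMl.
move: Q'_cube; rewrite ar; set b := Q'%:R; set t := T%:R => bC.
have b0 : 0 < b by rewrite ltr0n.
have t0 : 0 < t by rewrite ltr0n.
have -> : 6 * (r * b) * t ^+ 2 / b = 6 * r * t ^+ 2.
  by field; rewrite gt_eqF.
have -> : 32 * (r * b) ^+ 2 * b * t = 32 * r ^+ 2 * t * b ^+ 3 by ring.
have -> : 8 * (r * b) ^+ 3 * t = 8 * r ^+ 3 * t * b ^+ 3 by ring.
have rt : 0 <= r * t ^+ 2 by rewrite mulr_ge0 // sqr_ge0.
have h2 : 32 * r ^+ 2 * t * b ^+ 3 <= r * t ^+ 2.
  apply: le_trans (ler_wpM2l _ bC) _; first by rewrite !mulr_ge0 ?sqr_ge0 // ltW.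
  have -> : 32 * r ^+ 2 * t * (C * t) = (32 * (C * r)) * (r * t ^+ 2) by ring.
  by rewrite ler_piMl //; lra.
have h3 : 8 * r ^+ 3 * t * b ^+ 3 <= r * t ^+ 2.
  apply: le_trans (ler_wpM2l _ bC) _.
    by rewrite !mulr_ge0 ?exprn_ge0 // ltW.
  have -> : 8 * r ^+ 3 * t * (C * t) = (8 * (C * r)) * r * (r * t ^+ 2) by ring.
  by rewrite ler_piMl // mulr_ile1 //; lra.
have h4 : r * t ^+ 2 <= eps ^+ 2 / 10000 * t ^+ 2.
  by rewrite ler_wpM2r ?sqr_ge0 //; lra.
have -> : (eps * t / 2) ^+ 2 / 20 = 80^-1 * (eps ^+ 2 * t ^+ 2) by field.
have -> : 6 * r * t ^+ 2 = 6 * (r * t ^+ 2) by ring.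
have h5 : 0 <= eps ^+ 2 * t ^+ 2 by rewrite mulr_ge0 ?sqr_ge0.
by rewrite mulrAC in h4; lra.
Qed.

(** Here the variance is at most 65 r T^2, and 65/10^4 < 1/80: the tighter use of the constant
    10000. *)
Lemma dense_error :
  mean (fun sd : Om => (dense_est R G s Q smpV smpW sd.1.2 sd.2
     - \sum_(q in lastq G s) dense_coef R s smpW sd.2 q) ^+ 2)
  <= (eps * T%:R / 2) ^+ 2 / 20.
Proof.
rewrite (mean_VW (fun ov om => (dense_est R G s Q smpV smpW ov om
     - \sum_(q in lastq G s) dense_coef R s smpW om q) ^+ 2)).
have r0 : 0 <= (eps * T%:R / 2) ^+ 2 / 20 by rewrite divr_ge0 ?sqr_ge0.
case: Q_eps => [Q1 | Qs].
  apply: le_trans r0; rewrite (eq_mean (g := fun=> 0)) ?mean_const // => om.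
  by have [_ ->] := variance_unsampled s heavy Q_gt0 smpW smpEP smpVP Oe_gt0 Ov_gt0 om Q1.
apply: le_trans (dense_variance s_edges Q_gt0 smpVP smpWP Ov_gt0) _.
have [r [r0' ar Cr e0 e1]] := sampling_ratio Qs.
have rC : r <= C * r by rewrite ler_peMl.
rewrite ar; set b := Q'%:R; set t := T%:R.
have b0 : 0 < b by rewrite ltr0n.
have t0 : 0 < t by rewrite ltr0n.
have -> : 64 * (r * b) * t ^+ 2 / b = 64 * (r * t ^+ 2).
  by field; rewrite gt_eqF.
have -> : 64 * (r * b) ^+ 2 * t ^+ 2 / b ^+ 2 = (64 * r) * (r * t ^+ 2).
  by field; rewrite gt_eqF.
have rt : 0 <= r * t ^+ 2 by rewrite mulr_ge0 // sqr_ge0.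
have h2 : (64 * r) * (r * t ^+ 2) <= r * t ^+ 2.
  by rewrite ler_piMl //; lra.
have h4 : r * t ^+ 2 <= eps ^+ 2 / 10000 * t ^+ 2.
  by rewrite ler_wpM2r ?sqr_ge0 //; lra.
have -> : (eps * t / 2) ^+ 2 / 20 = 80^-1 * (eps ^+ 2 * t ^+ 2) by field.
have h5 : 0 <= eps ^+ 2 * t ^+ 2 by rewrite mulr_ge0 ?sqr_ge0.
by rewrite mulrAC in h4; lra.
Qed.

(** Deviations are measured from the means conditional on the third sample. These vary with it but
    add up to T by [sum_coef], so the third sample causes no error of its own. *)
Lemma success_prob :
  (7 / 10 : R) <= #|[pred sd : Om | within_capacity sd
                                    && approx eps T%:R (estimate sd)]|%:R
            / #|(Om : finType)|%:R.
Proof.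
set good := [pred sd : Om | _].
have N0 : 0 < #|(Om : finType)|%:R :> R by rewrite ltr0n !card_prod !muln_gt0 Oe_gt0 Ov_gt0.
pose dS (sd : Om) := sparse_est R G s heavy Q smpE smpW sd.1.1 sd.2
     - \sum_(q in lastq G s) sparse_coef R s smpW sd.2 q.
pose dD (sd : Om) := dense_est R G s Q smpV smpW sd.1.2 sd.2
     - \sum_(q in lastq G s) dense_coef R s smpW sd.2 q.
have a0 : 0 < eps * T%:R / 2.
  by have /andP[e0 _] := eps01; rewrite divr_gt0 // mulr_gt0 // ltr0n.
set a := eps * T%:R / 2 in a0.
pose B1 := [pred sd : Om | ~~ within_capacity sd].
pose B2 := [pred sd : Om | a ^+ 2 <= dS sd ^+ 2].
pose B3 := [pred sd : Om | a ^+ 2 <= dD sd ^+ 2].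
have h1 : #|B1|%:R / #|(Om : finType)|%:R <= 20^-1 :> R := prob_overflow.
have a2 : 0 < a ^+ 2 by rewrite exprn_gt0.
have h2 : #|B2|%:R / #|(Om : finType)|%:R <= 20^-1 :> R.
  apply: le_trans (markov_mean a2 (fun sd => sqr_ge0 (dS sd))) _.
  by rewrite ler_pdivrMr // mulrC; apply: sparse_error.
have h3 : #|B3|%:R / #|(Om : finType)|%:R <= 20^-1 :> R.
  apply: le_trans (markov_mean a2 (fun sd => sqr_ge0 (dD sd))) _.
  by rewrite ler_pdivrMr // mulrC; apply: dense_error.
have cover : (#|(Om : finType)| <= #|good| + (#|B1| + (#|B2| + #|B3|)))%N.
  apply: (@leq_trans #|[predU good & [predU B1 & [predU B2 & B3]]]|); last first.
    have U (A B : pred Om) : (#|[predU A & B]| <= #|A| + #|B|)%N.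
      by rewrite -cardUI leq_addr.
    apply: leq_trans (U _ _) _; rewrite leq_add2l.
    by apply: leq_trans (U _ _) _; rewrite leq_add2l; apply: U.
  apply/subset_leq_card/subsetP => sd _; rewrite !inE /good /=.
  have [_|_] := boolP (within_capacity sd); last by rewrite orbT.
  rewrite andTb orFb.
  have [_|] := leP (a ^+ 2) (dS sd ^+ 2); first by rewrite !orbT.
  have [_|] := leP (a ^+ 2) (dD sd ^+ 2); first by rewrite !orbT.
  rewrite !orbF => hD hS.
  have lt_norm (u : R) : u ^+ 2 < a ^+ 2 -> - a < u < a.
    by rewrite -real_normK ?num_real // ltr_pXn2r ?nnegrE ?(ltW a0) // ltr_norml.
  have e : estimate sd = T%:R + dS sd + dD sd.
    rewrite estimateE -(@sum_coef R _ G s s_edges Ow smpW sd.2) /dS /dD; ring.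
  have a2e : a + a = eps * T%:R by rewrite /a -splitr.
  rewrite /approx e mulrBl mulrDl mul1r -a2e.
  exact: between_add (lt_norm _ hS) (lt_norm _ hD).
rewrite -(ler_nat R) !natrD in cover.
rewrite ler_pdivlMr //; move: h1 h2 h3; rewrite !ler_pdivrMr // => h1 h2 h3.
exact: most_outside h1 h2 h3 N0 cover.
Qed.

End Success.


(** * Storing items in machine words *)

Lemma inj_of_card (A B : finType) : (#|A| <= #|B|)%N -> {f : A -> B | injective f}.
Proof.
move=> AB; exists (fun a => enum_val (widen_ord AB (enum_rank a))).
move=> a b /enum_val_inj/(congr1 val)/= /ord_inj; exact: enum_rank_inj.
Qed.

Section Items.
Variables (R : realType) (n kap : nat) (item seed : finType).
Hypothesis kap_gt0 : (0 < kap)%N.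
Variable enc : item -> kap.-tuple (word n).
Hypothesis enc_inj : injective enc.
Variables (rho : R) (rho_gt0 : 0 < rho).
Variables (init : seed -> seq item) (out : seq item -> R).
Variable step : seq item -> {set 'I_n} -> bool -> seq item.

Definition encode (st : seq item) : seq (word n) :=
  flatten [seq tval (enc i) | i <- st].

Definition decode (M : seq (word n)) : seq item :=
  pmap (fun w => [pick i | tval (enc i) == w])
       (reshape (nseq (size M %/ kap) kap) M).

Lemma size_encode (st : seq item) : size (encode st) = (kap * size st)%N.
Proof.
rewrite size_flatten /shape -map_comp (eq_map (g := fun=> kap)); last first.
  by move=> i /=; rewrite size_tuple.
by elim: st => [|i st IH] /=; rewrite ?muln0 // IH mulnS.
Qed.

Lemma encodeK : cancel encode decode.
Proof.
move=> st; rewrite /decode size_encode mulKn //.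
have -> : nseq (size st) kap = shape [seq tval (enc i) | i <- st].
  by elim: st => //= i st ->; rewrite size_tuple.
rewrite flattenK; elim: st => //= i st ->.
case: pickP => [j /eqP/val_inj/enc_inj -> // | /(_ i)].
by rewrite eqxx.
Qed.

(** All randomness comes from the first seed, handed to [init]; the seeds drawn on arrivals are
    ignored. *)
Definition item_alg : stream_alg R n :=
  StreamAlg rho_gt0 (fun sd => encode (init sd))
    (fun M e b (_ : seed) => encode (step (decode M) e b))
    (fun M => out (decode M)).

Variables (o : {set 'I_n} -> bool) (s : seq {set 'I_n}).

Definition item_state (sd : seed) (j : nat) : seq item :=
  foldl (fun st e => step st e (o e)) (init sd) (take j s).

Lemma scanl_encode (t : seq {set 'I_n}) (rs : seq seed) (st : seq item) :
  size rs = size t ->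
  scanl (fun M er => encode (step (decode M) er.1 (o er.1))) (encode st) (zip t rs)
  = [seq encode st' | st' <- scanl (fun st e => step st e (o e)) st t].
Proof.
by elim: t rs st => [|e t IH] [|r rs] //= st [/IH <-]; rewrite encodeK.
Qed.

Lemma item_later (r : coins item_alg s) :
  later_memories o r
  = [seq encode st | st <- scanl (fun st e => step st e (o e)) (init r.1) s].
Proof. by rewrite /later_memories scanl_encode // size_tuple. Qed.

Lemma item_memories (r : coins item_alg s) (M : seq (word n)) :
  M \in memories o r ->
  exists2 j, (j <= size s)%N & size M = (kap * size (item_state r.1 j))%N.
Proof.
rewrite /memories in_cons => /orP[/eqP-> | ].
  by exists 0%N; rewrite // /item_state take0 size_encode.
rewrite item_later => /mapP[st /(nthP [::])[j]]; rewrite size_scanl => js.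
rewrite nth_scanl // => <- ->; exists j.+1 => //; exact: size_encode.
Qed.

Lemma item_output (r : coins item_alg s) :
  output o r = out (item_state r.1 (size s)).
Proof.
rewrite /output item_later /= last_map encodeK /item_state take_size.
by congr out; elim: s (init r.1) => //= e t IH st.
Qed.

Lemma prob_seed (P : pred seed) : (0 < #|seed|)%N ->
  prob [pred r : coins item_alg s | P r.1] = #|P|%:R / #|seed|%:R.
Proof.
move=> seed0; rewrite /prob.
have -> : #|[pred r : coins item_alg s | P r.1]|
    = (#|P| * #|((size s).-tuple seed : finType)|)%N.
  rewrite -cardX; apply: eq_card => -[sd r]; by rewrite !inE andbT.
rewrite [#|coins _ _|]card_prod !natrM -mulf_div divff ?mulr1 //.
by rewrite pnatr_eq0 card_tuple -lt0n expn_gt0 seed0.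
Qed.

End Items.

(** * The algorithm as a state machine *)

Section Machine.
Variables (R : realType) (n : nat) (F : finFieldType).
Variables (D D' : {set F}) (Q N1 N2 : nat).
Variables (embV : 'I_n -> F) (embP : option ('I_n * 'I_n) -> F).

(** Endpoint pairs form a type of n^2 + 1 elements, which fits in O(1) words, unlike the type of all
    vertex sets. *)
Definition ends (e : {set 'I_n}) : option ('I_n * 'I_n) :=
  [pick p | e == [set p.1; p.2]].

Definition edge_of (p : option ('I_n * 'I_n)) : {set 'I_n} :=
  if p is Some (x, y) then [set x; y] else set0.

Lemma endsK (G : sgraph 'I_n) : {in edges G, cancel ends edge_of}.
Proof.
move=> e /imsetP[p _ ->]; rewrite /ends; case: pickP => [[x y] /eqP-> // | /(_ p)].
by rewrite eqxx.
Qed.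

Definition seeds : finType := (hash_seed F * hash_seed F * hash_seed F)%type.

Definition smpE (a : hash_seed F) (e : {set 'I_n}) : bool :=
  hash a (embP (ends e)) \in D.
Definition smpV (b : hash_seed F) (v : 'I_n) : bool := hash b (embV v) \in D.
Definition smpW (c : hash_seed F) (v : 'I_n) : bool := hash c (embV v) \in D'.

(** The first component counts arrivals, since the capacity depends on the position; the last is the
    doubled estimate. *)
Definition header : finType := ('I_N1.+1 * seeds * 'I_N2.+1)%type.
Definition item : finType := (header + option ('I_n * 'I_n) * bool)%type.

Definition stored (st : seq item) : seq ({set 'I_n} * bool) :=
  pmap (fun it => if it is inr (p, b) then Some (edge_of p, b) else None) st.

Definition init_state (sd : seeds) : seq item := [:: inl (ord0, sd, ord0)].

Definition light_item (it : item) : bool :=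
  if it is inr (p, b) then ~~ b else false.

(* The empty state is the absorbing failure state of a run that has exceeded its
   capacity. *)
Definition step_state (st : seq item) (e : {set 'I_n}) (b : bool) : seq item :=
  if st is inl (i, sd, a) :: K then
    let: (sE, sS, sW) := (smpE sd.1.1, smpV sd.1.2, smpW sd.2) in
    let K' := if keep sE sS sW e b then inr (ends e, b) :: K else K in
    if (count light_item K')%:R <= capacity R Q i.+1 then
      inl (inord i.+1, sd, inord (a + increment Q sE sS sW (stored K) e)) :: K'
    else [::]
  else [::].

Definition out_state (st : seq item) : R :=
  if st is inl (i, sd, a) :: K then (a : nat)%:R / 2 else 0.

Variables (G : sgraph 'I_n) (s : seq {set 'I_n}) (o : {set 'I_n} -> bool).
Hypothesis s_uniq : uniq s.
Hypothesis s_edges : s =i edges G.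
Hypothesis s_size : (size s <= N1)%N.
Hypothesis Q_gt0 : (0 < Q)%N.
Hypothesis N2_ge : (n ^ 4 * (3 * Q ^ 3) <= N2)%N.

Local Notation state := (item_state init_state step_state o s).

Definition kept (sd : seeds) (j : nat) : seq item :=
  rev [seq inr (ends f, o f) | f <- take j s
         & keep (smpE sd.1.1) (smpV sd.1.2) (smpW sd.2) f (o f)].

Definition tally_upto (sd : seeds) (j : nat) : nat :=
  (\sum_(q in lastq G s | last_edge q \in take j s)
     score Q (smpE sd.1.1) (smpV sd.1.2) (smpW sd.2) s o q)%N.

(** Keeps the tally in the range of its counter, so that [inord] returns it unchanged. *)
Lemma tally_le (sd : seeds) (j : nat) : (tally_upto sd j <= N2)%N.
Proof.
apply: leq_trans N2_ge.
apply: (@leq_trans (\sum_(q : quad 'I_n) 3 * Q ^ 3)%N).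
  rewrite /tally_upto big_mkcond; apply: leq_sum => q _; case: ifP => // _.
  exact: score_le.
rewrite sum_nat_const !card_prod card_ord leq_mul2r; apply/orP; right.
by rewrite !expnS expn0; lia.
Qed.

Lemma mem_stored_kept (sd : seeds) (j : nat) (f : {set 'I_n}) (b : bool) :
  ((f, b) \in stored (kept sd j)) = [&& f \in take j s, b == o f
     & keep (smpE sd.1.1) (smpV sd.1.2) (smpW sd.2) f b].
Proof.
rewrite mem_pmap; apply/mapP/and3P => [[it] | [ft /eqP-> kf]].
  rewrite mem_rev => /mapP[f']; rewrite mem_filter => /andP[kf' ft'] ->.
  rewrite (@endsK G) -?s_edges ?(mem_take ft') // => -[-> ->].
  by rewrite ft' eqxx kf'.
exists (inr (ends f, o f)).
  by rewrite mem_rev; apply/mapP; exists f; rewrite // mem_filter kf ft.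
by rewrite (@endsK G) // -s_edges (mem_take ft).
Qed.

Definition fits (sd : seeds) (j : nat) : bool :=
  all (fun i => (kept_light s o smpE smpV smpW sd i)%:R <= capacity R Q i)
      (iota 1 j).

Lemma count_light_kept (sd : seeds) (j : nat) :
  count light_item (kept sd j) = kept_light s o smpE smpV smpW sd j.
Proof.
by rewrite /kept count_rev count_map count_filter; apply: eq_count.
Qed.

Lemma keptS (sd : seeds) (j : nat) : (j < size s)%N ->
  kept sd j.+1 = let f := nth set0 s j in
    if keep (smpE sd.1.1) (smpV sd.1.2) (smpW sd.2) f (o f)
    then inr (ends f, o f) :: kept sd j else kept sd j.
Proof.
move=> js; rewrite /kept (take_nth set0) // filter_rcons.
by case: ifP => _ //; rewrite map_rcons rev_rcons.
Qed.

Lemma tallyS (sd : seeds) (j : nat) : (j < size s)%N ->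
  tally_upto sd j.+1 = (tally_upto sd j + increment Q (smpE sd.1.1)
    (smpV sd.1.2) (smpW sd.2) (stored (kept sd j)) (nth set0 s j))%N.
Proof.
move=> js; rewrite /tally_upto.
have S t := @sum_increments _ Q (smpE sd.1.1) (smpV sd.1.2) (smpW sd.2) G s
  s_edges o t (fun i => stored (kept sd i)) set0 s_uniq.
have Kp i f b (_ : (i < size s)%N) := mem_stored_kept sd i f b.
by rewrite -(S j.+1 js Kp) -(S j (ltnW js) Kp) big_ord_recr.
Qed.

(** Loop invariant. A failed capacity test is permanent because [fits] ranges over all earlier
    positions, in accordance with the absorbing empty state. *)
Lemma stateE (sd : seeds) (j : nat) : (j <= size s)%N ->
  state sd j = if fits sd j
    then inl (inord j, sd, inord (tally_upto sd j)) :: kept sd j else [::].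
Proof.
elim: j => [_|j IH js].
  rewrite /item_state /kept take0 /= /init_state /tally_upto take0.
  rewrite big_pred0 => [|q]; last by rewrite andbF.
  by congr [:: inl (_, _, _)]; apply/val_inj; rewrite /= inordK.
have -> : state sd j.+1 = step_state (state sd j) (nth set0 s j) (o (nth set0 s j)).
  by rewrite /item_state (take_nth set0) // foldl_rcons.
rewrite IH; last exact: ltnW.
have -> : fits sd j.+1 = fits sd j &&
    ((kept_light s o smpE smpV smpW sd j.+1)%:R <= capacity R Q j.+1).
  rewrite /fits (_ : iota 1 j.+1 = rcons (iota 1 j) j.+1) ?all_rcons 1?andbC //.
  by rewrite -cats1 -[j.+1]addn1 iotaD /= add1n addn1.
case: (fits sd j) => //=.
have jN : (j < N1.+1)%N by rewrite ltnS (leq_trans _ s_size) // ltnW.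
have K' := keptS sd js; rewrite /= in K'; rewrite -K' count_light_kept inordK //.
by case: ifP => // _; rewrite inordK ?ltnS ?tally_le // tallyS.
Qed.

Lemma capacity_le (i j : nat) : (i <= j)%N -> capacity R Q i <= capacity R Q j.
Proof.
move=> ij; rewrite /capacity ler_wpM2l ?divr_ge0 //.
have h0 k : 0 <= harmonic_sum R k.
  by apply: sumr_ge0 => l _; rewrite invr_ge0.
apply: ler_pM; rewrite ?exprn_ge0 ?ler_nat //.
by rewrite lerXn2r ?nnegrE // harmonic_sum_le.
Qed.

(** One header, the heavy edges, and the light edges that passed the capacity test; monotonicity of
    [capacity] covers the intermediate states. *)
Lemma size_state (sd : seeds) (j : nat) : (j <= size s)%N ->
  (size (state sd j))%:R <= 1 + (count o s)%:R + capacity R Q (size s).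
Proof.
move=> js; have c0 : 0 <= capacity R Q (size s).
  by apply: le_trans (capacity_le (leq0n (size s))); rewrite /capacity !mul0r mulr0.
rewrite stateE //; case: ifP => ft /=; last by rewrite !addr_ge0.
have szk : (size (kept sd j) <= count o s + kept_light s o smpE smpV smpW sd j)%N.
  rewrite size_rev size_map size_filter.
  apply: (@leq_trans (count o (take j s) + kept_light s o smpE smpV smpW sd j)).
    rewrite /kept_light -count_predUI; apply: leq_trans (leq_addr _ _).
    by apply: sub_count => f /=; case: (o f).
  by rewrite leq_add2r -{2}(cat_take_drop j s) count_cat leq_addr.
have cap : (kept_light s o smpE smpV smpW sd j)%:R <= capacity R Q (size s).
  case: j js ft {szk} => [_ _ | j js /allP ft]; first by rewrite /kept_light take0.
  apply: le_trans (capacity_le js); apply: ft.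
  by rewrite mem_iota /= add1n ltnS leqnn.
rewrite -natr1 addrC -addrA lerD2l.
apply: le_trans (_ : (count o s + kept_light s o smpE smpV smpW sd j)%:R <= _).
  by rewrite ler_nat.
by rewrite natrD lerD2l.
Qed.

Lemma out_stateE (sd : seeds) : fits sd (size s) ->
  out_state (state sd (size s)) = estimate R G s o Q smpE smpV smpW sd.
Proof.
move=> ft; rewrite stateE // ft /out_state inordK ?ltnS ?tally_le //.
rewrite /tally_upto /estimate take_size; congr (_%:R / _).
apply: eq_bigl => q; case qL : (q \in lastq G s) => //=.
case: q qL => [[[x y] z] w] /lastq_closed/closed4_adj/and4P[xy _ _ _] /=.
by rewrite (mem_stream s_edges).
Qed.

End Machine.


(** * Sampling rates and space *)

Section Rates.
Variable R : realType.

(** Q' is 2^l, where 8^l is the estimate rounded down to a power of 8. The cap [b] makes the rate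
    realizable in a field of order 2^b and is harmless because T <= 2^b. An estimate below 1 gives
    Q' = 1. *)
Lemma oracle_rate (C Tapx : R) (T b : nat)
    (Q' := (2 ^ minn b (trunc_log 8 (Num.truncn Tapx)))%N) :
  1 <= C -> (0 < T)%N -> (T <= 2 ^ b)%N -> T%:R / C <= Tapx <= C * T%:R ->
  Q'%:R ^+ 3 <= C * T%:R /\ T%:R <= 8 * C * Q'%:R ^+ 3.
Proof.
move=> C1 T0 Tb /andP[lT uT]; have C0 : 0 < C by apply: lt_le_trans C1.
have T1 : 1 <= T%:R :> R by rewrite ler1n.
have TC : T%:R <= C * T%:R by rewrite ler_peMl.
have A0 : 0 <= Tapx by apply: le_trans lT; rewrite divr_ge0 // ltW.
set l := trunc_log 8 _ in Q' *.
have cube k : (2 ^ k)%N%:R ^+ 3 = (8 ^ k)%N%:R :> R.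
  by rewrite -natrX -expnM mulnC expnM.
have [N0 | N0] := posnP (Num.truncn Tapx).
  have -> : Q' = 1%N by rewrite /Q' /l N0 trunc_log0 minn0.
  rewrite expr1n; split; first exact: le_trans TC.
  have : Tapx < 1 by rewrite ltNge -truncn_gt0 N0.
  by rewrite ler_pdivrMr // in lT => A1; nra.
have lN : (8 ^ l)%N%:R <= Tapx.
  apply: le_trans (_ : (Num.truncn Tapx)%:R <= _); last by rewrite truncn_le.
  by rewrite ler_nat trunc_logP.
rewrite /Q' cube; split.
  apply: le_trans uT; apply: le_trans lN.
  by rewrite ler_nat leq_pexp2l // geq_minr.
have [bl | lb] := leqP b l.
  rewrite -[leLHS]mul1r; apply: ler_pM => //; first lra.
  rewrite ler_nat (leq_trans Tb) // -[8%N]/(2 ^ 3)%N -expnM.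
  by rewrite leq_pexp2l // leq_pmull.
have A8 : Tapx <= (8 ^ l.+1)%N%:R.
  by rewrite ltW // -truncn_lt_nat // trunc_log_ltn.
rewrite ler_pdivrMr // in lT; rewrite expnS natrM in A8.
move: lT A8; set x : R := (8 ^ l)%N%:R => lT A8.
by apply: le_trans lT _; nra.
Qed.

(** Rounds [y] down to a power of 2; for [y] below 1 the truncation is 0, where [trunc_log] returns
    0, and so Q = 1. *)
Lemma sampling_rate (y : R) (a' : nat)
    (Q := (2 ^ minn a' (trunc_log 2 (Num.truncn y)))%N) :
  0 <= y -> y <= (2 ^ a')%N%:R ->
  (Q = 1%N \/ Q%:R <= y) /\ y <= 2 * Q%:R.
Proof.
move=> y0 ya; set l := trunc_log 2 _ in Q *.
have yl : y <= (2 ^ l.+1)%N%:R by rewrite ltW // -truncn_lt_nat // trunc_log_ltn.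
have hu : y <= 2 * Q%:R.
  have [al|la] := leqP a' l.
    by rewrite /Q (minn_idPl al) (le_trans ya) // ler_peMl // ler1n.
  by rewrite /Q (minn_idPr (ltnW la)) -natrM -expnS.
split=> //; have [N0 | N0] := posnP (Num.truncn y).
  by left; rewrite /Q /l N0 trunc_log0 minn0.
right; apply: le_trans (_ : (Num.truncn y)%:R <= _); last by rewrite truncn_le.
by rewrite ler_nat (leq_trans _ (trunc_logP (isT : 1 < 2)%N N0)) // leq_exp2l // geq_minr.
Qed.

Lemma sum_num_C4_at (V : finType) (G : sgraph V) :
  (\sum_(e in edges G) num_C4_at G e <= 4 * num_C4 G)%N.
Proof.
rewrite /num_C4_at; under eq_bigr do rewrite -sum1_card.
rewrite (exchange_big_dep (mem (four_cycles G))) /=; last first.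
  by move=> e F _; rewrite in_set => /andP[].
rewrite mulnC -sum_nat_const; apply: leq_sum => F FG; rewrite sum1_card.
move: FG; rewrite inE => /existsP[x /existsP[y /existsP[z /existsP[w]]]].
move=> /and5P[_ _ _ _ /andP[_ /eqP->]].
apply: (@leq_trans #|[:: [set x; y]; [set y; z]; [set z; w]; [set w; x]]|).
  apply/subset_leq_card/subsetP => e; rewrite unfold_in => /andP[_].
  by rewrite in_set => /andP[_]; rewrite /cycle4_edges !inE -!orbA.
exact: card_size.
Qed.

(** Each heavy edge is on at least T/Q' cycles, while there are at most 4T incidences of edges and
    cycles. *)
Lemma count_heavy (V : finType) (G : sgraph V) (s : seq {set V})
    (o : {set V} -> bool) (Q' : nat) :
  uniq s -> s =i edges G -> (0 < Q')%N -> (0 < num_C4 G)%N ->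
  perfect_oracle G (Q'%:R : R) o -> (count o s)%:R <= 4 * Q'%:R :> R.
Proof.
move=> us sG Q0 T0 oP.
have Q1 : 0 < Q'%:R :> R by rewrite ltr0n.
have T1 : 0 < (num_C4 G)%:R :> R by rewrite ltr0n.
have h : (count o s)%:R * ((num_C4 G)%:R / Q'%:R) <= (4 * num_C4 G)%:R :> R.
  apply: le_trans (_ : (\sum_(e in edges G) num_C4_at G e)%:R <= _); last first.
    by rewrite ler_nat sum_num_C4_at.
  rewrite natr_sum -sum1_count natr_sum mulr_suml (eq_bigl _ _ (fun e => esym (sG e))).
  rewrite -big_uniq //= big_mkcond [leRHS]big_seq big_seq; apply: ler_sum => e es.
  by case: ifP => // oe; rewrite mul1r -oP // -sG.
move: h; rewrite natrM mulrA ler_pdivrMr // mulrAC.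
by rewrite ler_pM2r.
Qed.

Lemma cube_root_pow (T : nat) : (T%:R `^ (3^-1) : R) ^+ 3 = T%:R.
Proof.
by rewrite -powR_mulrn ?powR_ge0 // -powRrM mulVf ?powRr1 // pnatr_eq0.
Qed.

(** The two summands of [f] have product at least m, so f^2 >= 4m by the inequality of means. Hence
    ln m <= 2 ln f, and f >= 2 absorbs the constant 1 into ln f / ln 2: logarithms of m become
    logarithms of [f]. *)
Lemma space_fun_bounds (eps t : R) (m : nat) (f := t + eps ^- 2 * (m%:R / t)) :
  0 < eps < 1 -> 1 <= t -> (0 < m)%N ->
  [/\ t <= f, eps ^- 2 * (m%:R / t) <= f, 2 <= f & 1 + ln m%:R <= (2 + (ln 2)^-1) * ln f].
Proof.
move=> /andP[e0 e1] t1 m0; have t0 : 0 < t by apply: lt_le_trans t1.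
have m1 : 1 <= m%:R :> R by rewrite ler1n.
have ei : 1 <= eps ^- 2 by rewrite invf_ge1 ?exprn_gt0 // expr_le1 // ltW.
set y := eps ^- 2 * (m%:R / t) in f *.
have y0 : 0 <= y by rewrite mulr_ge0 ?divr_ge0 ?(le_trans ler01) // ltW.
have ty : m%:R <= t * y.
  by rewrite /y mulrCA [t * _]mulrC divfK ?gt_eqF // ler_peMl.
have f4 : 4 * m%:R <= f ^+ 2.
  have := sqr_ge0 (t - y); rewrite /f; nra.
have f0 : 0 <= f by rewrite addr_ge0 // ltW.
have f2 : 2 <= f by nra.
have l2 : 0 < ln 2 :> R by rewrite ln_gt0 // ltr1n.
have lf : ln 2 <= ln f by rewrite ler_ln ?posrE //; lra.
split=> //; first by rewrite lerDl.
  by rewrite lerDr ltW.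
rewrite mulrDl addrC; apply: lerD; last by rewrite ler_pdivlMl // mulr1.
rewrite mulr_natl -lnXn; last by lra.
by rewrite ler_ln ?posrE ?exprn_gt0 //; try lra; rewrite ?ltr0n.
Qed.

End Rates.


(** * Word counts, total space and the final algorithm *)

Lemma card_item (n : nat) (F : finFieldType) (L := (trunc_log 2 n).+1) :
  #|F| = (2 ^ (4 * L))%N ->
  (#|item n F (2 ^ (2 * L)) (2 ^ (18 * L))| <= #|{: 100.-tuple (word n)}|)%N.
Proof.
move=> cF; have nL : (n < 2 ^ L)%N by rewrite trunc_log_ltn.
have -> : #|item n F (2 ^ (2 * L)) (2 ^ (18 * L))|
  = ((2 ^ (2 * L)).+1 * ((#|F| ^ 6) ^ 3) * (2 ^ (18 * L)).+1 + (n * n).+1 * 2)%N.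
  rewrite card_sum !card_prod !card_ord card_option card_prod card_ord card_bool.
  by rewrite !card_ffun card_ord; congr (_ * _ * _ + _)%N; rewrite !expnS expn0; ring.
rewrite !card_tuple card_bool cF -/L.
set p := (2 ^ L)%N in nL *.
have pE k : (2 ^ (k * L) = p ^ k)%N by rewrite mulnC expnM.
rewrite !pE -[((p ^ 4) ^ 6)%N]expnM -[((p ^ _) ^ 3)%N]expnM -/p.
have p2 : (2 <= p)%N by rewrite -[2%N]/(2 ^ 1)%N leq_pexp2l.
have S k : (0 < k)%N -> ((p ^ k).+1 <= p ^ k.+1)%N.
  move=> k0; have : (0 < p ^ k)%N by rewrite expn_gt0; case: (p) p2.
  by rewrite expnS; nia.
have h1 := S 2%N isT; have h2 := S 18%N isT.
(* A factor p = 2^L is one word: 3 for the position, 72 for the 18 hash coefficients, 19 for the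
   tally. Both kinds of items together fit in 95 words. *)
apply: (@leq_trans (p ^ 3 * p ^ 72 * p ^ 19 + p ^ 94)%N); last first.
  by rewrite -!expnD addnn -muln2 (leq_trans (leq_mul (leqnn _) p2)) // -expnSr leq_pexp2l //; lia.
apply: leq_add; first by rewrite !leq_mul.
apply: (@leq_trans (p ^ 2 * p)%N); last by rewrite -expnSr leq_pexp2l //; lia.
by apply: leq_mul => //; rewrite expnS expn1; nia.
Qed.

(** 100 words per item; the summands 1, 4C and 8 10^6 C^2 account for the header, the heavy edges
    and the light edges, and the square converts H_m^2 into (ln f)^2. *)
Definition space_const (R : realType) (C : R) : R :=
  100 * ((1 + 4 * C + 8 * 10 ^+ 6 * C ^+ 2) * (2 + (ln 2)^-1) ^+ 2).

Lemma stored_le_space (R : realType) (C eps : R) (m T Q Q' h : nat)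
    (f := space_fun eps m%:R T%:R) :
  1 <= C -> 0 < eps < 1 -> (0 < T)%N -> (0 < m)%N -> (0 < Q)%N ->
  Q'%:R ^+ 3 <= C * T%:R -> T%:R <= 8 * C * Q'%:R ^+ 3 ->
  eps ^+ 2 * Q'%:R <= 2 * (10000 * C * Q%:R) -> h%:R <= 4 * Q'%:R :> R ->
  100 * (1 + h%:R + capacity R Q m) <= softO (space_const C) 2 f.
Proof.
move=> C1 e01 T0 m0 Q0 Q'u Q'l Qe hQ; have /andP[e0 e1] := e01.
have C0 : 0 < C by apply: lt_le_trans C1.
set t : R := T%:R `^ 3^-1; have tE : t ^+ 3 = T%:R := cube_root_pow R T.
have t0 : 0 <= t by apply: powR_ge0.
have t1 : 1 <= t.
  by rewrite -(@ler_pXn2r _ 3) ?nnegrE // expr1n tE ler1n.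
(* Compared through cubes; C >= 1 allows C in place of C^(1/3), here and below. *)
have Q't : Q'%:R <= C * t.
  rewrite -(@ler_pXn2r _ 3) ?nnegrE ?mulr_ge0 ?(ltW C0) // exprMn tE.
  apply: le_trans Q'u _; rewrite ler_wpM2r // exprS ler_peMr // ?(ltW C0) //.
  by rewrite -[1](expr1n _ 2) lerXn2r ?nnegrE ?(ltW C0).
have tQ' : t <= 2 * C * Q'%:R.
  rewrite -(@ler_pXn2r _ 3) ?nnegrE ?mulr_ge0 ?(ltW C0) // exprMn tE.
  apply: le_trans Q'l _; rewrite ler_wpM2r ?exprn_ge0 //.
  have -> : (2 * C) ^+ 3 = 8 * (C * C ^+ 2) by ring.
  rewrite ler_pM2l // ler_peMr // ?(ltW C0) //.
  by rewrite -[1](expr1n _ 2) lerXn2r ?nnegrE ?(ltW C0).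
have [tf yf f2 lnf] := space_fun_bounds e01 t1 m0.
rewrite -/f in tf yf f2 lnf.
have fE : f = t + eps ^- 2 * (m%:R / t) by [].
rewrite -fE in tf yf f2 lnf.
set y := eps ^- 2 * (m%:R / t) in yf.
set g : R := 2 + (ln 2)^-1 in lnf.
have Qp : 0 < Q%:R :> R by rewrite ltr0n.
have tp : 0 < t by apply: lt_le_trans t1.
have H1 : 1 <= harmonic_sum R m by case: (m) m0 => // k _; apply: harmonic_sum_ge1.
have Hg : harmonic_sum R m <= g * ln f.
  apply: le_trans lnf; case: (m) m0 => // k _; exact: harmonic_sum_ln.
have H2 : 1 <= (g * ln f) ^+ 2.
  rewrite -[1](expr1n _ 2) lerXn2r ?nnegrE //; first by rewrite (le_trans _ Hg) ?(le_trans ler01).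
  exact: le_trans Hg.
have H3 : harmonic_sum R m ^+ 2 <= (g * ln f) ^+ 2.
  by rewrite lerXn2r ?nnegrE // ?(le_trans ler01) // (le_trans H1).
have cap : capacity R Q m <= 8 * 10 ^+ 6 * C ^+ 2 * (f * (g * ln f) ^+ 2).
  (* Combines t <= 2 C Q' with eps^2 Q' <= 20000 C Q. *)
  have inv : m%:R / Q%:R <= 4 * 10 ^+ 4 * C ^+ 2 * y.
    rewrite /y ler_pdivrMr //.
    have -> : 4 * 10 ^+ 4 * C ^+ 2 * (eps ^- 2 * (m%:R / t)) * Q%:R
      = m%:R * ((2 * C * (2 * (10000 * C * Q%:R))) / (eps ^+ 2 * t)).
      by field; rewrite !gt_eqF.
    rewrite ler_peMr // ler_pdivlMr ?mulr_gt0 ?exprn_gt0 // mul1r.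
    apply: (@le_trans _ _ (eps ^+ 2 * (2 * C * Q'%:R))).
      by rewrite ler_pM2l // exprn_gt0.
    by rewrite mulrCA ler_pM2l // mulr_gt0.
  have -> : capacity R Q m = 200 * (m%:R / Q%:R * harmonic_sum R m ^+ 2).
    by rewrite /capacity; field; rewrite gt_eqF.
  have -> : 8 * 10 ^+ 6 * C ^+ 2 * (f * (g * ln f) ^+ 2)
    = 200 * (4 * 10 ^+ 4 * C ^+ 2 * f * (g * ln f) ^+ 2) by ring.
  rewrite ler_pM2l // ler_pM ?divr_ge0 ?sqr_ge0 //.
  apply: le_trans inv _; rewrite ler_pM2l // !mulr_gt0 ?exprn_gt0 //.
have hf : h%:R <= 4 * C * (f * (g * ln f) ^+ 2).
  apply: le_trans hQ _; rewrite -mulrA ler_pM2l //.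
  apply: le_trans Q't _; rewrite ler_pM2l //; apply: le_trans tf _.
  by rewrite ler_peMr //; lra.
have f1 : 1 <= f * (g * ln f) ^+ 2.
  by rewrite -[1]mulr1 ler_pM //; lra.
have -> : softO (space_const C) 2 f = 100 * (f * (g * ln f) ^+ 2
    + 4 * C * (f * (g * ln f) ^+ 2) + 8 * 10 ^+ 6 * C ^+ 2 * (f * (g * ln f) ^+ 2)).
  by rewrite /softO /space_const -/g; ring.
by rewrite ler_pM2l // !lerD.
Qed.

Lemma streaming_alg (R : realType) (C : R) (n : nat) (eps Tapx : R) : 1 <= C ->
  exists A : stream_alg R n, forall (G : sgraph 'I_n) (s : seq {set 'I_n})
      (o : {set 'I_n} -> bool) (T := num_C4 G),
    0 < eps < 1 -> (0 < T)%N -> T%:R / C <= Tapx <= C * T%:R ->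
    edge_stream G s -> perfect_oracle G (sa_rho A) o ->
    uses_space A o s
      (softO (space_const C) 2 (space_fun eps #|edges G|%:R T%:R)) /\
    7 / 10 <= prob [pred r : coins A s | approx eps T%:R (output o r)].
Proof.
move=> C1; set L := (trunc_log 2 n).+1; pose b := (4 * L)%N.
(* Field elements of [b] bits take four words; vertices and endpoint pairs then embed in the field,
   and T is at most its order. *)
have nL : (n < 2 ^ L)%N by rewrite trunc_log_ltn.
have b0 : (0 < b)%N by [].
have [F _ cF] := pPrimePowerField (isT : prime 2) b0.
pose a' := minn b (trunc_log 8 (Num.truncn Tapx)); pose Q' := (2 ^ a')%N.
(* The largest Q that the variance bounds permit, before rounding. *)
pose y := eps ^+ 2 * Q'%:R / (10000 * C).
pose a := minn a' (trunc_log 2 (Num.truncn y)); pose Q := (2 ^ a)%N.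
have a'b : (a' <= b)%N by apply: geq_minl.
have aa' : (a <= a')%N by apply: geq_minl.
have Q0 : (0 < Q)%N by rewrite expn_gt0.
have Q'0 : (0 < Q')%N by rewrite expn_gt0.
have card_pow k : (k <= b)%N -> {D : {set F} | #|D| * 2 ^ k = #|F|}%N.
  move=> kb; have [|D cD] := @exists_set_card F (2 ^ (b - k)).
    by rewrite cF leq_pexp2l // leq_subr.
  by exists D; rewrite cD cF -expnD subnK.
have [D cD] := card_pow a (leq_trans aa' a'b); have [D' cD'] := card_pow a' a'b.
have F6 : (6 <= #|F|)%N.
  by rewrite cF (leq_trans (_ : 6 <= 2 ^ 4)%N) // leq_pexp2l // leq_pmulr.
have pL : (2 ^ b = (2 ^ L) * (2 ^ L) * ((2 ^ L) * (2 ^ L)))%N.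
  by rewrite -!expnD; congr (_ ^ _)%N; rewrite /b; lia.
have pL2 : (2 <= 2 ^ L)%N by rewrite -[2%N]/(2 ^ 1)%N leq_pexp2l.
have [embV embV_inj] : {f : 'I_n -> F | injective f}.
  apply: inj_of_card; rewrite card_ord cF pL -!mulnA.
  by rewrite (leq_trans (ltnW nL)) // leq_pmulr // !muln_gt0 !expn_gt0.
have [embP embP_inj] : {f : option ('I_n * 'I_n) -> F | injective f}.
  apply: inj_of_card; rewrite card_option card_prod card_ord cF pL.
  by rewrite (leq_trans (ltn_mul nL nL)) // leq_pmulr // !muln_gt0 !expn_gt0.
(* There are at most n^2 arrivals, and the tally is at most 3 n^4 Q^3, where Q <= 2^(4L) and 3 <=
   2^(2L): the exponent is 4 + 2 + 12. *)
pose N1 := (2 ^ (2 * L))%N; pose N2 := (2 ^ (18 * L))%N.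
have [enc enc_inj] := inj_of_card (card_item cF).
have Q'R : 0 < Q'%:R :> R by rewrite ltr0n.
exists (item_alg enc Q'R (init_state n N1 N2) (@out_state R n F N1 N2)
  (step_state R D D' Q embV embP)) => G s o T e01 T0 Tap [us sG] oP.
have /andP[e0 e1] := e01; have C0 : 0 < C by apply: lt_le_trans C1.
have sz : size s = #|edges G| by rewrite -(card_uniqP us); apply: eq_card.
have szn : (size s <= n * n)%N.
  rewrite sz (leq_trans (leq_imset_card _ _)) // (leq_trans (max_card _)) //.
  by rewrite card_prod card_ord.
have m0 : (0 < size s)%N.
  rewrite sz card_gt0; have : (0 < #|lastq G s|)%N by rewrite (card_lastq sG) muln_gt0.
  case/card_gt0P => -[[[x y0] z] w] /lastq_closed/closed4_adj/and4P[xy _ _ _].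
  by apply/set0Pn; exists [set x; y0]; rewrite mem_edges.
have sN1 : (size s <= N1)%N.
  by apply: leq_trans szn _; rewrite /N1 mul2n -addnn expnD leq_mul // ltnW.
have Qb : (Q <= 2 ^ b)%N by rewrite leq_pexp2l // (leq_trans aa').
have N2Q : (n ^ 4 * (3 * Q ^ 3) <= N2)%N.
  have -> : N2 = ((2 ^ L) ^ 4 * ((2 ^ L) ^ 2 * (2 ^ b) ^ 3))%N.
    by rewrite -!expnM -!expnD; congr (_ ^ _)%N; rewrite /b; lia.
  rewrite leq_mul ?leq_exp2r ?(ltnW nL) // leq_mul ?leq_exp2r //.
  by rewrite (leq_trans (_ : 3 <= 2 ^ 2)%N) // leq_exp2r.
have Tb : (T <= 2 ^ b)%N.
  have : (2 * T <= n ^ 4)%N.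
    rewrite -(card_lastq sG) (leq_trans (max_card _)) // !card_prod card_ord.
    by rewrite !expnS expn0 !mulnA muln1.
  have : (n ^ 4 <= 2 ^ b)%N.
    by rewrite /b mulnC expnM leq_exp2r // ltnW.
  by lia.
have [Q'u Q'l] := oracle_rate C1 T0 Tb Tap; rewrite -/a' -/Q' in Q'u Q'l.
have y_ge0 : 0 <= y by rewrite divr_ge0 ?mulr_ge0 ?sqr_ge0 // ltW.
have y_le : y <= Q'%:R.
  rewrite ler_pdivrMr ?mulr_gt0 // mulrC ler_wpM2l //.
  apply: (@le_trans _ _ 1); first by rewrite expr_le1 // ltW.
  by lra.
have [Qy yQ] := sampling_rate y_ge0 y_le; rewrite -/a -/Q in Qy yQ.
have c10 : 0 < 10000 * C by rewrite mulr_gt0.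
have kap0 : (0 < 100)%N by [].
split.
  move=> r M /(item_memories kap0 enc_inj)[j js ->]; rewrite natrM -sz.
  apply: le_trans (stored_le_space (Q := Q) (Q' := Q') (h := count o s) _ _ _ _ _ _ _ _ _) => //.
  - rewrite ler_pM2l //.
    exact: (size_state R D D' embV embP o us sG sN1 Q0 N2Q r.1 js).
  - have -> : 2 * (10000 * C * Q%:R) = 2 * Q%:R * (10000 * C) by ring.
    by rewrite -ler_pdivrMr.
  - exact: (count_heavy us sG).
have smE : sampler R (edges G) 6 Q (smpE D embP).
  apply: hash_sampler => // e f eG fG /embP_inj; exact: (can_in_inj (@endsK n G)).
have smV : sampler R [set: 'I_n] 6 Q (smpV D embV).
  by apply: hash_sampler => // u v _ _; apply: embV_inj.
have smW : sampler R [set: 'I_n] 6 Q' (smpW D' embV).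
  by apply: hash_sampler => // u v _ _; apply: embV_inj.
have H0 : (0 < #|{: hash_seed F}|)%N.
  by rewrite card_ffun card_ord expn_gt0 (leq_trans _ F6).
have Qe : Q = 1%N \/ 10000 * C * Q%:R <= eps ^+ 2 * Q'%:R.
  by case: Qy => [->|h]; [left | right; rewrite ler_pdivlMr // mulrC in h].
have QQ' : (Q <= Q')%N by rewrite leq_pexp2l.
have := success_prob us sG Q0 QQ' oP smE smV smW H0 H0 H0 e01 T0 C1 Q'u Qe.
set good := [pred sd | _] => h; apply: le_trans h _.
rewrite -(prob_seed enc Q'R (init_state n N1 N2) (@out_state R n F N1 N2)
  (step_state R D D' Q embV embP) s good); last first.
  by rewrite !card_prod !muln_gt0 H0.
rewrite /prob ler_wpM2r ?invr_ge0 // ler_nat; apply/subset_leq_card/subsetP => r.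
rewrite !inE => /andP[fit apx].
by rewrite (item_output kap0 enc_inj) (out_stateE us sG sN1 Q0 N2Q).
Qed.

Theorem theorem1p3 (R : realType) (K C : R) (hK : 0 < K) (hC : 1 <= C) :
  exists (c : R) (k : nat)
         (alg : forall (n : nat) (eps Tapx : R), stream_alg R n),
  forall (n : nat) (eps Tapx : R) (G : sgraph 'I_n)
         (s : seq {set 'I_n}) (o : {set 'I_n} -> bool),
    let A := alg n eps Tapx in
    let m := #|edges G| in
    let T := num_C4 G in
    0 < eps < 1 ->
    (0 < T)%N ->
    T%:R `^ (- 6^-1) <= K * eps ->
    T%:R / C <= Tapx <= C * T%:R ->
    edge_stream G s ->
    perfect_oracle G (sa_rho A) o ->
    uses_space A o s (softO c k (space_fun eps m%:R T%:R)) /\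
    7 / 10 <= prob [pred r : coins A s | approx eps T%:R (output o r)].
Proof.
(* The algorithm depends on [n], [eps] and [Tapx] alone, being chosen before the graph, the stream
   and the oracle; [boolp.cid] turns its existence into a function. *)
pose spec n eps Tapx := boolp.cid (streaming_alg n eps Tapx hC).
exists (space_const C), 2%N, (fun n eps Tapx => sval (spec n eps Tapx)).
move=> n eps Tapx G s o A m T e01 T0 _; exact: (svalP (spec n eps Tapx)).
Qed.
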